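(* Let $D$ be a link diagram. If $D$ is $+$-adequate and the graph $G_{s_+}(D)$ has a cycle of length at least $3$, or if $D$ is $-$-adequate and the graph $G_{s_-}(D)$ has a cycle of length at least $3$, then the Khovanov homology $\bigoplus_{i,j}H_{i,j}(D)$ contains $\mathbb{Z}_2$-torsion, i.e. it has an element of order $2$.
   Context: Cycles in graphs are simple closed paths (no repeated vertices). Kauffman states. Let $D$ be an unoriented link diagram. A Kauffman state $s$ assigns a marker $+1$ or $-1$ to each crossing; each crossing is smoothed according to its marker ($+1$ gives the $A$-smoothing of the Kauffman bracket, $-1$ the $B$-smoothing). $D_s$ is the resulting system of circles. $s_+$ (resp. $s_-$) is the state with all markers $+1$ (resp. $-1$). The graph $G_s(D)$ has vertices the circles of $D_s$ and one edge for each crossing of $D$, joining the (possibly equal) circles of $D_s$ meeting at that crossing. $D$ is $+$-adequate (resp. $-$-adequate) if $G_{s_+}(D)$ (resp. $G_{s_-}(D)$) has no loops. Khovanov homology (Viro's framed version). An enhanced Kauffman state $S$ is a Kauffman state $s$ together with a sign $+$ or $-$ on each circle of $D_s$. Let $\sigma(S)$ be the number of positive markers minus the number of negative markers and $\tau(S)$ the number of positive circles minus the number of negative circles. $\mathcal{C}_{i,j}(D)$ is the free abelian group on the enhanced states with $\sigma(S)=i$ and $\sigma(S)+2\tau(S)=j$. After ordering the crossings, $d:\mathcal{C}_{i,j}(D)\to\mathcal{C}_{i-2,j}(D)$ is $d(S)=\sum_{S'}(-1)^{t(S:S')}[S:S']S'$, where $[S:S']=1$ if $S\in\mathcal{C}_{i,j}$,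 $S'\in\mathcal{C}_{i-2,j}$, the markers of $S$ and $S'$ differ at exactly one crossing $c$ (so $c$ is positive in $S$, negative in $S'$, and $\tau(S')=\tau(S)+1$) and all circles not touching $c$ have the same signs in $S$ and $S'$; $[S:S']=0$ otherwise; $t(S:S')$ is the number of negative markers of $S$ at crossings bigger than $c$. $H_{i,j}(D)$ is the homology of this complex at $\mathcal{C}_{i,j}(D)$. *)

(* Defs.v *)
From HB Require Import structures.
From mathcomp Require Import all_boot all_order all_algebra.
From mathcomp Require Import boolp.

Set Implicit Arguments.
Unset Strict Implicit.
Unset Printing Implicit Defensive.

Import GRing.Theory.
Local Open Scope ring_scope.

(* A crossing has four ends, numbered 0, 1, 2, 3 counterclockwise around it in
   such a way that 0 and 2 are the ends of the lower strand, 1 and 3 those of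
   the upper strand; the numbers are taken in 'Z_4. *)
Definition crossing_end (n : nat) := ('I_n * 'Z_4)%type.

Definition next_end n (e : crossing_end n) : crossing_end n := (e.1, e.2 + 1).

(* A diagram with crossings 'I_n is given by the pairing [opp_end] of the 4n
   ends by the 2n edges of the underlying 4-valent plane graph, together with
   the number of components without crossings.  An arbitrary pairing describes
   a diagram on a closed oriented surface, each connected component of the graph
   lying on its own component of the surface, with faces (the discs glued to
   the graph) the orbits of [next_end \o opp_end].  It is a diagram on the
   sphere iff the genera are all 0, i.e. iff V - E + F = 2 c for V = n
   vertices, E = 2n edges, F faces and c connected components of the graph.
   Not recorded: which region of the complement of the other components
   contains a given connected component of the diagram; neither the circles of
   a Kauffman state nor the crossings they touch depend on it. *)
Definition same_edge_or_crossing n (opp : crossing_end n -> crossing_end n) :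
    rel (crossing_end n) :=
  [rel e e' | (e' == opp e) || (e' == next_end e)].

Definition planar n (opp : crossing_end n -> crossing_end n) : Prop :=
  (n + fcard (fun e => next_end (opp e)) predT =
   n.*2 + 2 * n_comp (same_edge_or_crossing opp) predT)%N.

Record link_diagram := LinkDiagram {
  ncross : nat;
  nfree : nat;
  opp_end : crossing_end ncross -> crossing_end ncross;
  opp_endK : involutive opp_end;
  opp_end_neq : forall e, opp_end e != e;
  opp_end_planar : planar opp_end
}.

Section States.
Variable D : link_diagram.

Definition crossing := 'I_(ncross D).

(* The markers +1 and -1 are true and false. *)
Definition state := {ffun crossing -> bool}.

Definition marker (b : bool) : int := if b then 1 else -1.

(* Turning the upper strand (ends 1, 3) counterclockwise sweeps the regions
   between the ends 1, 2 and between the ends 3, 0; the A-smoothing merges these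
   two regions, so it connects 0 with 1 and 2 with 3, that is k with 1 - k.  The
   B-smoothing connects 1 with 2 and 3 with 0, that is k with -1 - k. *)
Definition smoothing (b : bool) (k : 'Z_4) : 'Z_4 :=
  (if b then 1 else -1) - k.

Definition smooth (s : state) (e : crossing_end (ncross D)) :
  crossing_end (ncross D) := (e.1, smoothing (s e.1) e.2).

(* Points on the circles of a state: the ends at the crossings, and one point
   on each component without crossings. *)
Definition point := (crossing_end (ncross D) + 'I_(nfree D))%type.

Definition next_point (s : state) : rel point := fun x y =>
  match x, y with
  | inl e, inl e' => (e' == opp_end e) || (e' == smooth s e)
  | _, _ => false
  end.

(* A circle of D_s is represented by the set of the points on it. *)
Definition circle_through (s : state) (x : point) : {set point} :=
  [set y | connect (next_point s) x y].

Definition circles (s : state) : {set {set point}} :=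
  [set circle_through s x | x in [set: point]].

Definition circle (s : state) := {A : {set point} | A \in circles s}.

Lemma circle_through_in s x : circle_through s x \in circles s.
Proof. by apply: imset_f; rewrite inE. Qed.

Definition circle_at (s : state) (x : point) : circle s :=
  Sub (circle_through s x) (circle_through_in s x).

(* The edge of G_s(D) given by the crossing c.  The ends 0 and 2 of c are never
   connected by the smoothing of c, so they lie on its two different arcs. *)
Definition edge_ends (s : state) (c : crossing) : circle s * circle s :=
  (circle_at s (inl (c, 0)), circle_at s (inl (c, 2%:R))).

Definition adjacent (s : state) : rel (circle s) := fun A B =>
  [exists c, (edge_ends s c == (A, B)) || (edge_ends s c == (B, A))].

Definition loopless (s : state) : Prop :=
  forall c, (edge_ends s c).1 != (edge_ends s c).2.

(* A cycle is given by its vertices; when there are at least 3 of them and they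
   are distinct, the edges joining consecutive vertices are distinct too. *)
Definition has_cycle_ge3 (s : state) : Prop :=
  exists p : seq (circle s), (3 <= size p)%N /\ ucycle (@adjacent s) p.

Definition state_plus : state := [ffun=> true].
Definition state_minus : state := [ffun=> false].

Definition plus_adequate : Prop := loopless state_plus.
Definition minus_adequate : Prop := loopless state_minus.

Definition enhanced := {s : state & {ffun circle s -> bool}}.

Definition sigma (S : enhanced) : int := \sum_(c : crossing) marker (tag S c).

Definition tau (S : enhanced) : int :=
  \sum_(A : circle (tag S)) marker (tagged S A).

Definition bidegree (S : enhanced) : int * int :=
  (sigma S, sigma S + 2 * tau S).

Definition touches (c : crossing) (A : {set point}) : bool :=
  [exists k, inl (c, k) \in A].

Definition differ_only_at (c : crossing) (S S' : enhanced) : bool :=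
  [forall c', (tag S c' != tag S' c') == (c' == c)].

(* A circle not touching c is the same set of points in both states. *)
Definition same_signs_off (c : crossing) (S S' : enhanced) : bool :=
  [forall A : circle (tag S), forall A' : circle (tag S'),
     (val A == val A') && ~~ touches c (val A) ==>
     (tagged S A == tagged S' A')].

Definition incident_at (c : crossing) (S S' : enhanced) : bool :=
  [&& bidegree S' == ((bidegree S).1 - 2, (bidegree S).2),
      differ_only_at c S S' & same_signs_off c S S'].

Definition neg_after (c : crossing) (S : enhanced) : nat :=
  #|[set c' : crossing | (c < c')%N && ~~ tag S c']|.

(* (-1)^{t(S:S')} [S:S']; the sum has at most one nonzero term. *)
Definition incidence (S S' : enhanced) : int :=
  \sum_(c : crossing | incident_at c S S') (-1) ^+ neg_after c S.

Definition basis (ij : int * int) := {S : enhanced | bidegree S == ij}.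

Definition chain (ij : int * int) := {ffun basis ij -> int}.

(* The component C_ij -> C_kl of the differential; it vanishes unless
   kl = (i - 2, j). *)
Definition diff (ij kl : int * int) (x : chain ij) : chain kl :=
  [ffun S' => \sum_(S : basis ij) x S * incidence (val S) (val S')].

Lemma diff_is_zmod_morphism ij kl : zmod_morphism (@diff ij kl).
Proof.
move=> x y; apply/ffunP => S'; rewrite !ffunE -sumrB.
by apply: eq_bigr => S _; rewrite !ffunE mulrBl.
Qed.

HB.instance Definition _ ij kl :=
  GRing.isZmodMorphism.Build (chain ij) (chain kl) (@diff ij kl)
    (@diff_is_zmod_morphism ij kl).

End States.

Section Homology.
Variables (U V W : zmodType) (f : {additive U -> V}) (g : {additive V -> W}).

Definition is_cycle : {pred V} := fun z => g z == 0.

Lemma is_cycle_zmod_closed : zmod_closed is_cycle.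
Proof.
split=> [|x y]; rewrite !unfold_in; first by rewrite raddf0.
by move=> /eqP gx0 /eqP gy0; rewrite raddfB gx0 gy0 subrr.
Qed.

HB.instance Definition _ :=
  GRing.isZmodClosed.Build V is_cycle is_cycle_zmod_closed.

Record cycles := Cycle { cycle_val :> V; _ : cycle_val \in is_cycle }.

HB.instance Definition _ := [isSub for cycle_val].
HB.instance Definition _ := [Choice of cycles by <:].
HB.instance Definition _ := [SubChoice_isSubZmodule of cycles by <:].

Definition is_boundary : {pred cycles} := fun z => `[< exists u, val z = f u >].

Lemma is_boundary_zmod_closed : zmod_closed is_boundary.
Proof.
split=> [|x y]; rewrite !unfold_in.
  by apply/asboolP; exists 0; rewrite !raddf0.
move=> /asboolP[u xu] /asboolP[v yv]; apply/asboolP.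
by exists (u - v); rewrite !raddfB /= xu yv.
Qed.

HB.instance Definition _ :=
  GRing.isZmodClosed.Build cycles is_boundary is_boundary_zmod_closed.

(* ker g / (im f :&: ker g); this is ker g / im f when g \o f = 0. *)
Definition homology : zmodType := @Quotient.quot cycles is_boundary.

End Homology.

Section DirectSum.
Variables (I : eqType) (V : I -> zmodType).

Definition family := forall i, V i.

HB.instance Definition _ := gen_eqMixin family.
HB.instance Definition _ := gen_choiceMixin family.

Definition family0 : family := fun=> 0.
Definition family_opp (x : family) : family := fun i => - x i.
Definition family_add (x y : family) : family := fun i => x i + y i.

Lemma family_addA : associative family_add.
Proof. by move=> x y z; apply: functional_extensionality_dep => i; apply: addrA. Qed.

Lemma family_addC : commutative family_add.
Proof. by move=> x y; apply: functional_extensionality_dep => i; apply: addrC. Qed.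

Lemma family_add0 : left_id family0 family_add.
Proof. by move=> x; apply: functional_extensionality_dep => i; apply: add0r. Qed.

Lemma family_addN : left_inverse family0 family_opp family_add.
Proof. by move=> x; apply: functional_extensionality_dep => i; apply: addNr. Qed.

HB.instance Definition _ := GRing.isZmodule.Build family
  family_addA family_addC family_add0 family_addN.

Definition finite_support : {pred family} :=
  fun x => `[< exists s : seq I, forall i, i \notin s -> x i = 0 >].

Lemma finite_support_zmod_closed : zmod_closed finite_support.
Proof.
split=> [|x y]; rewrite !unfold_in; first by apply/asboolP; exists [::].
move=> /asboolP[s xs] /asboolP[t yt]; apply/asboolP.
exists (s ++ t) => i; rewrite mem_cat negb_or => /andP[/xs xi0 /yt yi0].
by rewrite -[LHS]/(x i - y i) xi0 yi0 subrr.
Qed.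

HB.instance Definition _ :=
  GRing.isZmodClosed.Build family finite_support finite_support_zmod_closed.

Record direct_sum :=
  DirectSum { dsum_val :> family; _ : dsum_val \in finite_support }.

HB.instance Definition _ := [isSub for dsum_val].
HB.instance Definition _ := [Choice of direct_sum by <:].
HB.instance Definition _ := [SubChoice_isSubZmodule of direct_sum by <:].

End DirectSum.

Definition khovanov_at (D : link_diagram) (ij : int * int) : zmodType :=
  homology (@diff D (ij.1 + 2, ij.2) ij) (@diff D ij (ij.1 - 2, ij.2)).

Definition khovanov (D : link_diagram) : zmodType := direct_sum (khovanov_at D).

Definition has_element_of_order_2 (V : zmodType) : Prop :=
  exists x : V, x != 0 /\ x *+ 2 = 0.

(* Main.v *)
From mathcomp Require Import all_boot all_order all_algebra.
From mathcomp Require Import boolp zify ring.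
Require Import Defs.

Set Implicit Arguments.
Unset Strict Implicit.
Unset Printing Implicit Defensive.

Import GRing.Theory Num.Theory.
Local Open Scope ring_scope.
Local Open Scope quotient_scope.

(** Let s be the adequate state, and describe an enhanced state by the set F of
    crossings flipped from s and the set U of its special circles, those with
    sign - for s_+ and with sign + for s_-.  The differential enlarges F for s_+
    and shrinks it for s_-, so that up to signs both cases concern the same
    matrices K, whose entries are the steps (F, U) -> (c |: F, U') near
    F = set0, read as they are or transposed.  In either reading 2-torsion comes
    from vectors z and phi such that z K = 2 y, K phi = 2 psi and
    y . phi = z . psi is odd: if y (for s_+) or psi (for s_-) is a cycle, its
    class has order 2, since it pairs to an odd number with phi, respectively z,
    which is a cocycle mod 2.

    Let G be the set of edges of the graph cycle; having length at least 3, it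
    has no parallel edges.  If #|G| is odd, z is the sum of the states (set0, U)
    with #|U| = 1, and phi is the indicator of the states ([set e], set0) with e
    in G; y is then the sum of all the ([set e], set0), so y . phi = #|G|.
    If #|G| is even, fix e0 in G; z is the sum of the states ([set e], U) with e
    parallel to e0 and #|U| = 1, and phi is the indicator of the states
    ([set e; f], set0) with e and f in G; y . phi is then #|G| - 1 mod 2.

    Planarity and d^2 = 0 are not needed: a step that keeps the number of circles
    contributes nothing to the differential, for parity reasons. *)

(** * Parity of integers, through the field with two elements *)

Definition parity (x : int) : 'F_2 := x%:~R.

Lemma parity_eq0 x : (parity x == 0) = (2 %| x)%Z.
Proof.
have nat_eq0 m : ((m%:R : 'F_2) == 0) = (2 %| m)%N.
  by rewrite (dvdn_pcharf (pchar_Fp (isT : prime 2))).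
by case: x => m; rewrite /parity ?NegzE ?mulrNz ?oppr_eq0 nat_eq0 // dvdzE.
Qed.

Lemma parity_nat m : parity m%:R = (odd m)%:R.
Proof.
rewrite /parity -[m in LHS]odd_double_half -muln2 natrD natrM.
by rewrite rmorphD rmorphM !rmorph_nat /= [2%:R](pchar_Fp_0 (isT : prime 2))
  mulr0 addr0.
Qed.

Lemma parityM x y : parity (x * y) = parity x * parity y.
Proof. exact: rmorphM. Qed.

Lemma parity_sum (I : finType) (P : pred I) (f : I ->
  int) : parity (\sum_(i | P i) f i) = \sum_(i | P i) parity (f i).
Proof. exact: rmorph_sum. Qed.

Lemma parity_sign m x : parity ((-1) ^+ m * x) = parity x.
Proof.
rewrite /parity rmorphM /= rmorphXn /= rmorphN1 (_ : -1 =
  1 :> 'F_2) ?expr1n ?mul1r //.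
exact: val_inj.
Qed.

Lemma sum_set1 (V : finType) (R : zmodType) (P : pred {set V}) (g : {set V} ->
  R) :
  \sum_(U | P U && (#|U| == 1%N)) g U = \sum_(w | P [set w]) g [set w].
Proof.
rewrite -(big_imset g (A := [pred w | P [set w]]) (h := set1)) /=;
  last by move=> ? ? _ _ /set1_inj.
apply: eq_bigl => U; apply/andP/imsetP => [[PU /cards1P[w defU]]|[w Pw ->]].
  by exists w; rewrite // -topredE /= -defU.
by rewrite cards1.
Qed.

(** * Circles and changes of markers *)

Lemma fixfree_involution_even (T : finType) (f : T -> T) (A : {set T}) :
  involutive f -> {in A, forall x, f x != x} -> {in A, forall x, f x \in A} ->
  ~~ odd #|A|.
Proof.
move=> fK; have [n] := ubnP #|A|; elim: n A => // n IHn A leAn f_neq fA.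
have [->|[x xA]] := set_0Vmem A; first by rewrite cards0.
have fxA : f x \in A :\ x by rewrite !inE f_neq ?fA.
have cardA := cardsD1 x A; have cardA' := cardsD1 (f x) (A :\ x).
rewrite xA in cardA; rewrite fxA in cardA'.
rewrite cardA cardA' /= negbK; apply: IHn; first by lia.
  by move=> y; rewrite !inE => /and3P[_ _ /f_neq].
move=> y; rewrite !inE => /and3P[y_neq_fx y_neq_x yA].
by rewrite fA // (can_eq fK) (inv_eq fK) y_neq_fx y_neq_x.
Qed.

Lemma eq_connect_in (T : finType) (r r' : rel T) (x : T) :
  (forall y z, connect r x y -> r y z = r' y z) -> connect r x =1 connect r' x.
Proof.
move=> eq_r.
have to_r' p y : connect r x y -> connect r' x y -> path r y p ->
    connect r' x (last y p).
  elim: p y => //= z p IHp y xy xy' /andP[ryz]; apply: IHp.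
    exact: connect_trans xy (connect1 ryz).
  by apply: (connect_trans xy'); apply: connect1; rewrite -eq_r.
have to_r p y : connect r x y -> path r' y p -> connect r x (last y p).
  elim: p y => //= z p IHp y xy /andP[r'yz]; apply: IHp.
  by apply: (connect_trans xy); apply: connect1; rewrite eq_r.
by move=> y; apply/idP/idP => /connectP[p xp ->]; [apply: to_r' | apply: to_r].
Qed.

Section Surgery.
Variable D : link_diagram.
Implicit Types (s : state D) (c : crossing D) (A : {set point D}).

Definition flip c s : state D := [ffun c' => s c' (+) (c' == c)].

Lemma flipK c : involutive (flip c).
Proof. by move=> s; apply/ffunP=> c'; rewrite !ffunE -addbA addbb addbF. Qed.

Lemma flip_neq c s c' : c' != c -> flip c s c' = s c'.
Proof. by move=> /negbTE ne; rewrite ffunE ne addbF. Qed.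

Lemma flip_eq c s : flip c s c = ~~ s c.
Proof. by rewrite ffunE eqxx addbT. Qed.

Lemma smoothingK b : involutive (smoothing b).
Proof. by move=> k; rewrite /smoothing subKr. Qed.

Lemma smoothing_neq b k : smoothing b k != k.
Proof. by case: b; case: k => [[|[|[|[|k]]]] lt4]. Qed.

Lemma smoothK s : involutive (smooth s).
Proof. by move=> [c k]; rewrite /smooth /= smoothingK. Qed.

Lemma next_point_sym s : symmetric (next_point s).
Proof.
move=> [e|i] [e'|j] //=; rewrite !(eq_sym e').
by rewrite (inv_eq (@opp_endK D)) (inv_eq (smoothK s)).
Qed.

Lemma connect_point_sym s : connect_sym (next_point s).
Proof. exact: sym_connect_sym (@next_point_sym s). Qed.

Lemma eq_circle_through s x y :
  (circle_through s x == circle_through s y) = connect (next_point s) x y.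
Proof.
apply/eqP/idP => [/setP/(_ y)|xy]; first by rewrite !inE connect0.
by apply/setP=> z; rewrite !inE (same_connect (@connect_point_sym s) xy).
Qed.

Lemma circles_through s A x :
  A \in circles s -> x \in A -> A = circle_through s x.
Proof.
by move=> /imsetP[y _ ->]; rewrite inE -eq_circle_through => /eqP.
Qed.

Lemma next_point_flip c s x y :
  (forall k, x != inl (c, k)) -> next_point (flip c s) x y = next_point s x y.
Proof.
case: x y => [[c' k]|i] [e|j] //= /(_ k) ne.
have {}ne : c' != c by apply: contraNneq ne => ->.
by rewrite /smooth /= flip_neq.
Qed.

(** No step from a point of such a circle depends on the marker of [c], so its component is the same
    for both states. *)
Lemma circles_flip c s A :
  ~~ touches c A -> (A \in circles (flip c s)) = (A \in circles s).
Proof.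
move: A => A ntA.
suff sub s' : A \in circles s' -> A \in circles (flip c s').
  by apply/idP/idP => /sub //; rewrite flipK.
move=> {s} As; have [x _ defA] := imsetP As.
suff -> : A = circle_through (flip c s') x by apply: circle_through_in.
apply/setP=> y; rewrite defA !inE; apply: eq_connect_in => {}y z xy.
rewrite next_point_flip // => k; apply: contraNneq ntA => yk.
by apply/existsP; exists k; rewrite -yk defA inE.
Qed.

Definition touching s c := [set A in circles s | touches c A].

Lemma connect_smoothing s c k :
  connect (next_point s) (inl (c, k)) (inl (c, smoothing (s c) k)).
Proof. by apply: connect1; rewrite /= /smooth eqxx orbT. Qed.

Lemma smoothing_cover b k :
  [|| k == 0, k == smoothing b 0, k == 2%:R | k == smoothing b 2%:R].
Proof. by case: b; case: k => [[|[|[|[|k]]]] lt4]. Qed.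

Lemma smoothing_negb b : smoothing (~~ b) (smoothing b 0) = 2%:R.
Proof. by case: b; apply: val_inj. Qed.

Lemma connect_crossing_ends s c k :
  connect (next_point s) (inl (c, 0)) (inl (c, k)) \/
  connect (next_point s) (inl (c, 2%:R)) (inl (c, k)).
Proof.
by case/or4P: (smoothing_cover (s c) k) => /eqP->;
  rewrite ?connect0 ?connect_smoothing; auto.
Qed.

(** Each of the two arcs at a smoothed crossing contains exactly one of the ends 0 and 2, so these
    two ends represent every circle through [c]. *)
Lemma touchingE s c : touching s c =
  [set circle_through s (inl (c, 0)); circle_through s (inl (c, 2%:R))].
Proof.
apply/setP=> A; rewrite !inE; apply/andP/orP => [[As /existsP[k kA]]|].
  rewrite (circles_through As kA) !eq_circle_through !(connect_point_sym s (inl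
    (c, k))).
  exact: connect_crossing_ends.
by case=> /eqP->; split; rewrite ?circle_through_in //; apply/existsP;
  [exists 0 | exists 2%:R]; rewrite inE connect0.
Qed.

Lemma card_touching s c :
  #|touching s c| = (~~ connect (next_point s) (inl (c, 0%R)) (inl (c, 2%:R))).+1.
Proof. by rewrite touchingE cards2 -eq_circle_through. Qed.

(** The circles that avoid [c] are common to both states, so the points on the remaining circles are
    the same too. *)
Lemma cover_touching_flip c s :
  cover (touching (flip c s) c) = cover (touching s c).
Proof.
suff sub s' : cover (touching s' c) \subset cover (touching (flip c s') c).
  by apply/eqP; rewrite eqEsubset -{2}(flipK c s) !sub.
apply/bigcupsP=> A; rewrite inE => /andP[As cA]; apply/subsetP=> y yA.
apply/bigcupP; exists (circle_through (flip c s') y);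
  last by rewrite inE connect0.
rewrite inE circle_through_in /=; apply: contraTT cA => ntc.
rewrite (circles_through As yA) (_ : circle_through s' y =
  circle_through (flip c s') y) //.
apply/esym/circles_through; last by rewrite inE connect0.
by rewrite -(circles_flip s' ntc) circle_through_in.
Qed.

(* The end [(c, 0)] is joined, without passing through [c], to an odd number of
   other ends of [c]: on the set of ends reachable that way, [opp_end] and
     [smooth s]
   are involutions without fixed points, the latter off [c] only. *)
Lemma connect_flip_merge c s :
  ~~ connect (next_point s) (inl (c, 0)) (inl (c, 2%:R)) ->
  connect (next_point (flip c s)) (inl (c, 0)) (inl (c, 2%:R)).
Proof.
move=> nc02.
pose r : rel (crossing_end (ncross D)) :=
  [rel e e' | (e' == opp_end e) || (e.1 != c) && (e' == smooth s e)].
have r_connect s' (e : crossing_end _) : (forall c', c' != c -> s' c' = s c') ->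
    connect r (c, 0) e -> connect (next_point s') (inl (c, 0)) (inl e).
  move=> eq_s' /connectP[p rp ->]; elim: p (c, 0) rp => [|e' p IHp] e0 /=.
    by rewrite connect0.
  case/andP=> re' /IHp; apply: connect_trans; apply: connect1 => /=.
  case/orP: re' => [-> //|/andP[ne0 /eqP->]].
  by rewrite /smooth eq_s' // eqxx orbT.
pose K := [set e | connect r (c, 0) e].
have K_opp : {in K, forall e, opp_end e \in K}.
  move=> e; rewrite !inE => /connect_trans; apply; apply: connect1.
  by rewrite /r /= eqxx.
have K_even : ~~ odd #|K|.
  apply: (fixfree_involution_even (@opp_endK D)) K_opp => e _.
  exact: opp_end_neq.
pose E := [set e : crossing_end (ncross D) | e.1 == c].
have KD_even : ~~ odd #|K :\: E|.
  apply: (fixfree_involution_even (smoothK s)) => [[c' k] _|[c' k]].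
    by rewrite xpair_eqE eqxx smoothing_neq.
  rewrite !inE /= => /andP[ne /connect_trans cK].
  by rewrite ne; apply: cK; apply: connect1; rewrite /r /= ne eqxx orbT.
have KE0 : (c, 0) \in K :&: E by rewrite !inE connect0 eqxx.
have := cardsID E K; rewrite (cardsD1 (c, 0) (K :&: E)) KE0 => cardK.
have /set0Pn[[c' k]] : (K :&: E) :\ (c, 0) != set0.
  by apply: contraNneq K_even => K0; move: cardK KD_even; rewrite K0 cards0 => <-.
rewrite !inE => /and3P[ne0 cK] /eqP /= defc; rewrite {c'}defc in ne0 cK.
have c0k := r_connect s _ (fun _ _ => erefl) cK.
have {}ne0 : k != 0 by apply: contraNneq ne0 => ->.
(* The other two ends lie on the arc of the end 2, which [s] does not join to 0. So [k] is the
   partner of 0 in [s], and the flipped smoothing joins that partner to 2. *)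
have defk : k = smoothing (s c) 0.
  apply/eqP; case/or4P: (smoothing_cover (s c) k) ne0 =>
    // [->//|/eqP k2|/eqP k2] _.
    by rewrite k2 (negPf nc02) in c0k.
  case/negP: nc02; apply: connect_trans c0k _.
  by rewrite k2 connect_point_sym connect_smoothing.
have c0k' : connect (next_point (flip c s)) (inl (c, 0)) (inl (c, k)).
  by apply: r_connect cK => c'; apply: flip_neq.
apply: connect_trans c0k' _; rewrite defk.
by rewrite -[X in connect _ _ (inl (_, X))](smoothing_negb (s c)) -flip_eq
  connect_smoothing.
Qed.

Lemma touching_flip_merge c s : #|touching s c| = 2%N ->
  touching (flip c s) c = [set cover (touching s c)].
Proof.
rewrite card_touching -cover_touching_flip => /eqP/[!eqSS]/[!eqb1] nc02.
have := connect_flip_merge nc02; rewrite -eq_circle_through touchingE => /eqP->.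
by rewrite setUid /cover big_set1.
Qed.

Lemma touches_bigcup (I : finType) (P : pred I) (F : I -> {set point D}) c :
  touches c (\bigcup_(i | P i) F i) = [exists (i | P i), touches c (F i)].
Proof.
apply/existsP/existsP => [[k /bigcupP[i Pi kFi]]|[i /andP[Pi /existsP[k kFi]]]].
  by exists i; rewrite Pi; apply/existsP; exists k.
by exists k; apply/bigcupP; exists i.
Qed.

End Surgery.

(** * Chains near an adequate state *)

(* [circ F] stands for the set of circles of the state with [F] flipped, and
   [meets c A] for the circle [A] touching the crossing [c]. *)
Section Core.
Variables (I V : finType) (lt : rel I).
Variables (circ : {set I} -> {set V}) (meets : I -> pred V).
Implicit Types (F : {set I}) (U : {set V}) (c e f : I).

Definition touch F c := [set A in circ F | meets c A].

Hypothesis lt_total : forall c d, c != d -> lt d c = ~~ lt c d.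
Hypothesis circ_off : forall c F A, c \notin F -> ~~ meets c A ->
  (A \in circ (c |: F)) = (A \in circ F).
Hypothesis card_touch : forall F c, (0 < #|touch F c| <= 2)%N.
(** [W] is the union of the two circles at [c], whence the crossings it meets. *)
Hypothesis touch_merge : forall F c, c \notin F -> #|touch F c| = 2%N ->
  exists2 W, touch (c |: F) c = [set W] &
    forall f, meets f W = [exists A in touch F c, meets f A].
Hypothesis loopless0 : forall c, #|touch set0 c| = 2%N.

(* The first conjunct says that tau, up to the sign exchanged between the two
   cases, increases by 1. *)
Definition step c F U U' :=
  (#|circ (c |: F)| + #|U|.*2 == (#|circ F| + #|U'|.*2).+1)%N &&
  [forall A in circ F, meets c A || ((A \in U) == (A \in U'))].

(** For s_+ this is $(-1)^{t(S:S')}$, the negative markers being the flipped crossings. *)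
Definition step_sign c F : int := (-1) ^+ #|[set c' in F | lt c c']|.

(* [step_image z] is z K and [step_pullback y] is K y. *)
Definition step_image (z : {set I} -> {set V} -> int) F U' : int :=
  \sum_(c in F) step_sign c (F :\ c) *
    \sum_(U : {set V} | (U \subset circ (F :\ c)) &&
      step c (F :\ c) U U') z (F :\ c) U.

Definition step_pullback (y : {set I} -> {set V} -> int) F U : int :=
  \sum_(c in ~: F) step_sign c F *
    \sum_(U' : {set V} | (U' \subset circ (c |: F)) &&
      step c F U U') y (c |: F) U'.

(** * Effect of one flip on the number of circles and on the special circles *)

Lemma card_circ_step c F : c \notin F ->
  (#|circ (c |: F)| + #|touch F c| = #|circ F| + #|touch (c |: F) c|)%N.
Proof.
move=> cF.
have split_touch F' : #|circ F'| =
  (#|touch F' c| + #|[set A in circ F' | ~~ meets c A]|)%N.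
  rewrite -(cardsID [set A | meets c A] (circ F')); congr (_ + _)%N;
  by apply: eq_card => A; rewrite !inE // andbC.
rewrite !split_touch [in RHS](_ : [set A in circ F | _] =
  [set A in circ (c |: F) | ~~ meets c A]).
  by lia.
by apply/setP=> A; rewrite !inE; case ntc: (meets c A);
  rewrite ?andbF // circ_off ?ntc.
Qed.

Lemma card_touch_merge c F : c \notin F -> #|touch F c| = 2%N ->
  #|touch (c |: F) c| = 1%N.
Proof. by move=> cF T2; have [W -> _] := touch_merge cF T2; rewrite cards1. Qed.

Lemma card_circ_merge c F : c \notin F -> #|touch F c| = 2%N ->
  #|circ F| = #|circ (c |: F)|.+1.
Proof. by move=> cF T2; have := card_circ_step cF;
  rewrite T2 card_touch_merge //; lia. Qed.

Lemma card_touch12 F c : #|touch F c| = 1%N \/ #|touch F c| = 2%N.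
Proof. by have := card_touch F c; lia. Qed.

Lemma card_circ_le c F : c \notin F -> (#|circ (c |: F)| <= #|circ F|.+1)%N.
Proof. by move=> cF; have := card_circ_step cF; have := card_touch F c;
  have := card_touch (c |: F) c; lia. Qed.

Definition lifts c F U' := #|[set w in circ F | step c F [set w] U']|.

(** This is the source of the factor 2: in a merge to a non-special circle, either of the two
    circles at [c] can be the special one. Without a merge the number of circles does not drop, and
    the count in [step] fails. *)
Lemma lifts_set0 c F : c \notin F ->
  lifts c F set0 = if #|touch F c| == 2%N then 2%N else 0%N.
Proof.
move=> cF; rewrite /lifts; have [T1|T2] := card_touch12 F c.
  rewrite T1 /=; apply/eqP; rewrite cards_eq0; apply/eqP/setP=> w.
  rewrite !inE /step cards1 cards0; have := card_circ_step cF;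
    have := card_touch (c |: F) c.
  by rewrite T1 => t1 t2; apply/negbTE; rewrite !negb_and; apply/orP; right;
    apply/orP; left; lia.
rewrite T2 /= -T2; apply: eq_card => w; rewrite !inE /step cards1 cards0.
rewrite (card_circ_merge cF T2) addn0 addn2 eqxx /=.
have [wF|//] := boolP (w \in circ F); rewrite /=;
  apply/forall_inP/idP => [/(_ w wF)|cw A _].
  by rewrite !inE eqxx; case: meets.
by rewrite !inE; case: (A =P w) => [->|]; rewrite ?cw ?orbT.
Qed.

(** The count in [step] leaves only a split with one special circle: a merge would force [U'] to be
    empty, and a constant number of circles is excluded by parity. *)
Lemma lifts_neq0 c F U' : c \notin F -> U' != set0 -> U' \subset circ (c |: F) ->
  lifts c F U' = [&& #|touch F c| == 1%N, #|touch (c |: F) c| == 2%N & #|U'| ==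
    1%N].
Proof.
move=> cF U'n0 U's; rewrite /lifts; have := card_circ_step cF.
have := card_touch12 (c |: F) c; rewrite -cards_eq0 in U'n0.
have [T1|T2] := card_touch12 F c; last first.
  rewrite T2 /= => _ _; apply/eqP; rewrite cards_eq0; apply/eqP/setP=> w.
  rewrite !inE /step cards1; have := card_circ_merge cF T2 => t1.
  by apply/negbTE; rewrite !negb_and; apply/orP; right; apply/orP; left; lia.
have [/eqP T'2 _|T'n2] := boolP (#|touch (c |: F) c| == 2%N); last first.
  rewrite andbF T1 => t0 t1; apply/eqP; rewrite cards_eq0; apply/eqP/setP=> w.
  rewrite !inE /step cards1.
  by apply/negbTE; rewrite !negb_and; apply/orP; right; apply/orP; left; lia.
have [/cards1P[u defU]|Un1] := boolP (#|U'| == 1%N); last first.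
  rewrite andbF T1 => t1; apply/eqP; rewrite cards_eq0; apply/eqP/setP=> w.
  rewrite !inE /step cards1.
  by apply/negbTE; rewrite !negb_and; apply/orP; right; apply/orP; left; lia.
rewrite T1 T'2 /= => t1; clear U'n0; rewrite {U'}defU sub1set in U's *.
have /cards1P[W defW] := introT eqP T1.
(* Undoing the split: a special circle at [c] comes from the unique circle [W] that splits, any
   other one is unchanged. *)
apply/eqP/cards1P; exists (if meets c u then W else u); apply/setP=> w.
rewrite !inE /step !cards1 (_ : (_ == _)%N) //=; last by lia.
have /setP touchW := defW.
case cu: (meets c u); last first.
  have uF : u \in circ F by rewrite -(circ_off cF) ?cu.
  apply/andP/eqP => [[_ /forall_inP/(_ u uF)]|->].
    by rewrite cu !inE eqxx /= eqb_id => /eqP.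
  by split=> //; apply/forall_inP => A _; rewrite eqxx orbT.
have WT : W \in touch F c by rewrite defW set11.
apply/andP/eqP => [[wF /forall_inP/(_ w wF)]|->].
  rewrite !inE eqxx; case cw: (meets c w) => /=; last first.
    by case: (w =P u) => // wu; rewrite wu cu in cw.
  by move=> _; apply/set1P; rewrite -defW inE wF.
move: WT; rewrite inE => /andP[WF _]; split=> //; apply/forall_inP=> A AF.
case cA: (meets c A) => //=; rewrite !inE; apply/eqP.
have -> : (A == W) = false.
  by apply: contraFF cA => /eqP->; have := set11 W; rewrite -defW inE => /andP[].
by apply/esym; apply: contraFF cA => /eqP->.
Qed.

(** * Chains supported on states with one or no special circle *)

Definition one_special k (a : {set I} -> int) F U : int :=
  if (#|F| == k) && (#|U| == 1%N) then a F else 0.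

(** Only merges count here, each once; the factor 2 of their two lifts is split off. *)
Definition half_image (a : {set I} -> int) F : int :=
  \sum_(c in F | #|touch (F :\ c) c| == 2%N) step_sign c (F :\ c) * a (F :\ c).

Definition no_special k (b : {set I} -> int) F U : int :=
  if (#|F| == k) && (U == set0) then b F else 0.

Lemma sum_one_special k a c F U' : #|F| = k ->
  \sum_(U : {set V} | (U \subset circ F) &&
    step c F U U') one_special k a F U = (lifts c F U')%:R * a F.
Proof.
move=> Fk; rewrite /one_special Fk eqxx /= -big_mkcondr /=.
rewrite (sum_set1 (fun U =>
  (U \subset circ F) && step c F U U')) sumr_const mulr_natl.
congr (_ *+ _); apply: eq_card => w; rewrite !inE.
by rewrite -topredE /= sub1set.
Qed.

Lemma sum_no_special k b F (P : pred {set V}) : #|F| = k ->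
  \sum_(U | P U) no_special k b F U = (P set0)%:R * b F.
Proof.
move=> Fk; rewrite /no_special Fk eqxx /= -big_mkcondr /=; case P0: (P set0).
  rewrite (big_pred1 set0) ?mul1r // => U /=; have [->|] := eqVneq U set0;
    by rewrite ?P0 ?andbF.
by rewrite mul0r big_pred0 // => U; have [->|] := eqVneq U set0;
  rewrite ?P0 ?andbF.
Qed.

Lemma sum_no_special_neq k b F (P : pred {set V}) : #|F| != k ->
  \sum_(U | P U) no_special k b F U = 0.
Proof. by move=> /negbTE Fk; rewrite big1 // => U _; rewrite /no_special Fk. Qed.

Lemma card_setD1 c F : c \in F -> #|F| = #|F :\ c|.+1.
Proof. by move=> cF; rewrite (cardsD1 c F) cF. Qed.

Lemma setD1_notin c F : c \notin F :\ c.
Proof. by rewrite !inE eqxx. Qed.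

(** At [set0] every merge contributes twice. At a singleton only splits contribute, once each, and
    their sum is the one assumed to vanish; larger [U'] receive nothing. *)
Lemma step_image_one_special k a F U' : U' \subset circ F ->
  (#|F| = k.+1 -> \sum_(c in F | (#|touch (F :\ c) c| == 1%N) &&
    (#|touch F c| == 2%N))
      step_sign c (F :\ c) * a (F :\ c) = 0) ->
  step_image (one_special k a) F U' = 2 * no_special k.+1 (half_image a) F U'.
Proof.
move=> U's H; rewrite /step_image /no_special.
have [/eqP Fk|Fk] /= := boolP (#|F| == k.+1); last first.
  rewrite mulr0 big1 // => c cF; rewrite big1 ?mulr0 // => U _;
    rewrite /one_special.
  by rewrite -eqSS -(card_setD1 cF) (negbTE Fk).
rewrite (eq_bigr (fun c =>
  step_sign c (F :\ c) * ((lifts c (F :\ c) U')%:R * a (F :\ c)))); last first.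
  by move=> c cF; rewrite sum_one_special //; have := card_setD1 cF;
    rewrite Fk => -[].
have [->|U'n0] /= := eqVneq U' set0.
  rewrite /half_image big_mkcondr mulr_sumr; apply: eq_bigr => c cF.
  by rewrite lifts_set0 ?setD1_notin //; case: eqP => _;
    rewrite ?mul0r ?mulr0 // mulrCA.
rewrite mulr0.
have [U'1|U'n1] := boolP (#|U'| == 1%N); last first.
  rewrite big1 // => c cF; rewrite lifts_neq0 ?setD1_notin ?setD1K //.
  by rewrite (negbTE U'n1) !andbF mul0r mulr0.
rewrite -[RHS](H Fk) [RHS]big_mkcondr; apply: eq_bigr => c cF.
rewrite lifts_neq0 ?setD1_notin ?setD1K // U'1 andbT.
by case: ifP => _; rewrite ?mul1r // mul0r mulr0.
Qed.

(** The hypothesis on circles says that all [k] flips merge, that is, the flipped edges form a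
    forest. As one flip adds at most one circle, a step from [set0] must be a split ending at
    [set0]. *)
Lemma step_image_no_special k b F U : U \subset circ F ->
  (forall F', #|F'| = k -> b F' != 0 -> (#|circ F'| + k)%N = #|circ set0|) ->
  (#|F| = k.+1 -> \sum_(c in F) step_sign c (F :\ c) * b (F :\ c) = 0) ->
  step_image (no_special k b) F U = 0.
Proof.
move=> Us forest H; rewrite /step_image;
  have [/eqP Fk|Fk] := boolP (#|F| == k.+1); last first.
  rewrite big1 // => c cF; rewrite sum_no_special_neq ?mulr0 //.
  by rewrite -eqSS -(card_setD1 cF).
(* All [F :\ c] with a nonzero coefficient have the same number of circles, so whether the flip of
   [c] splits depends on [F] alone and factors out of the sum. *)
pose P := (U == set0) && (#|circ F| + k == #|circ set0|.+1)%N.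
rewrite (eq_bigr (fun c => P%:R * (step_sign c (F :\ c) * b (F :\ c)))).
  by rewrite -mulr_sumr H ?mulr0.
move=> c cF; have Fck : #|F :\ c| = k by have := card_setD1 cF; rewrite Fk => -[].
rewrite sum_no_special // sub0set /= [RHS]mulrCA; congr (_ * _).
have [->|/(forest _ Fck) bF] := eqVneq (b (F :\ c)) 0; first by rewrite !mulr0.
congr (_%:R * _); congr nat_of_bool; rewrite /step cards0 setD1K //.
have := card_circ_le (setD1_notin c F); rewrite setD1K // => leF.
have [U0|Un0] := eqVneq U set0.
  rewrite /P U0 cards0 eqxx /= andb_idr => [|_]; first by apply/eqP/eqP; lia.
  by apply/forall_inP=> A _; rewrite eqxx orbT.
rewrite /P (negbTE Un0) /=; apply/negbTE; rewrite negb_and; apply/orP; left.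
by move: Un0; rewrite -cards_eq0; lia.
Qed.

Lemma step_set0 c F U : c \notin F -> #|touch F c| = 2%N -> U \subset circ F ->
  step c F U set0 = (#|U| == 1%N) && (U \subset [set A | meets c A]).
Proof.
move=> cF T2 Us; rewrite /step cards0 (card_circ_merge cF T2); congr (_ && _).
  by apply/eqP/eqP; lia.
apply/forall_inP/subsetP => [H A AU|H A AF]; rewrite !inE.
  by have := H A (subsetP Us _ AU); rewrite AU !inE; case: meets.
by case AU: (A \in U); rewrite ?orbT //; move: (H _ AU); rewrite inE => ->.
Qed.

(** * The indicator of the states whose flipped set lies in G *)

Section SubsetCochain.
Variables (k : nat) (G : {set I}).
Hypothesis forestG : forall F c, F \subset G -> #|F| = k -> c \in G :\: F ->
  #|touch F c| = 2%N.
Hypothesis evenG : forall F w, F \subset G -> #|F| = k -> w \in circ F ->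
  ~~ odd #|[set c in G :\: F | meets c w]|.

Definition subset_cochain := no_special k.+1 (fun F => (F \subset G)%:R).

Lemma step_pullback_subset F U : step_pullback subset_cochain F U =
  if #|F| == k then
    \sum_(c in ~: F) step_sign c F * ((step c F U set0)%:R *
      (c |: F \subset G)%:R) else 0.
Proof.
rewrite /step_pullback; have [Fk|Fk] := boolP (#|F| == k).
  apply: eq_bigr => c; rewrite inE => cF; rewrite sum_no_special ?sub0set //.
  by rewrite cardsU1 cF (eqP Fk).
by rewrite big1 // => c; rewrite inE => cF;
  rewrite sum_no_special_neq ?mulr0 // cardsU1 cF eqSS.
Qed.

(** A merge at [c] to a non-special circle starts from one special circle at [c]; so at [(F,
    [set w])] the value counts, modulo 2, the edges of [G :\: F] at the circle [w]. *)
Lemma step_pullback_subset_even F U : U \subset circ F ->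
  (2 %| step_pullback subset_cochain F U)%Z.
Proof.
move=> Us; rewrite -parity_eq0 step_pullback_subset; case: (#|F| =P k) => // Fk.
have [FG|FnG] := boolP (F \subset G); last first.
  rewrite big1 // => c _; rewrite subUset (negbTE FnG) andbF !mulr0 //.
rewrite parity_sum.
rewrite (eq_bigr (fun c => parity ((step c F U set0 && (c \in G))%:R)));
  last first.
  by move=> c _; rewrite parity_sign -natrM mulnb subUset FG andbT sub1set.
have [/cards1P[w defU]|Un1] := boolP (#|U| == 1%N); last first.
  rewrite big1 // => c; rewrite inE => cF; case cG: (c \in G);
    last by rewrite andbF.
  by rewrite step_set0 ?(negbTE Un1) // forestG // inE cF cG.
rewrite -parity_sum -natr_sum parity_nat; apply/eqP.
rewrite (_ : (\sum_(i in ~: F) _)%N = #|[set c in G :\: F | meets c w]|).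
  by rewrite (negbTE (evenG FG Fk _)) // -sub1set -defU.
rewrite -sum1_card big_mkcond [RHS]big_mkcond /=; apply: eq_bigr => c _.
rewrite !inE; have [cF|cF] //= := boolP (c \in F).
case cG: (c \in G); last by rewrite andbF.
by rewrite step_set0 ?forestG // ?inE ?cF // defU cards1 sub1set inE; case: meets.
Qed.

Lemma subset_cochain_pairing a : \sum_F \sum_(U : {set V} | U \subset circ F)
  no_special k.+1 a F U * subset_cochain F U =
  \sum_(F : {set I} | (#|F| == k.+1) && (F \subset G)) a F.
Proof.
rewrite [RHS]big_mkcond; apply: eq_bigr => F _; rewrite (bigD1 set0) ?sub0set //=.
rewrite big1 ?addr0 => [|U /andP[_ /negbTE U0]];
  last by rewrite /no_special U0 andbF mul0r.
rewrite /subset_cochain /no_special eqxx andbT; case: eqP => _;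
  rewrite ?mul0r //=.
by case: (F \subset G); rewrite ?mulr1 ?mulr0.
Qed.
End SubsetCochain.

(** * Signs, and flips of one or two crossings from the adequate state *)

Lemma sum_set2 (R : zmodType) (g : I -> R) c d : c != d ->
  \sum_(e in [set c; d]) g e = g c + g d.
Proof. by move=> cd; rewrite big_setU1 ?inE // big_set1. Qed.

Lemma set2D1l c d : c != d -> [set c; d] :\ c = [set d].
Proof. by move=> cd; rewrite setU1K // inE. Qed.

Lemma set2D1r c d : c != d -> [set c; d] :\ d = [set c].
Proof. by move=> cd; rewrite setUC set2D1l // eq_sym. Qed.

Lemma step_sign0 c : step_sign c set0 = 1.
Proof. by rewrite /step_sign eq_card0 // => d; rewrite !inE. Qed.

Lemma step_signU1 c d F : d \notin F ->
  step_sign c (d |: F) = (-1) ^+ (lt c d) * step_sign c F.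
Proof.
move=> dF; rewrite /step_sign -exprD; congr (_ ^+ _).
case cd: (lt c d).
  rewrite (cardsD1 d) !inE eqxx cd /=; congr (_ + _)%N; apply: eq_card => e.
  by rewrite !inE; case: eqP => // ->; rewrite (negbTE dF).
by apply: eq_card => e; rewrite !inE; case: eqP => // ->; rewrite cd (negbTE dF).
Qed.

Definition order_sign c d : int := (-1) ^+ (lt c d).

Lemma step_sign1 c d : step_sign c [set d] = order_sign c d.
Proof. by rewrite -[[set d]]setU0 step_signU1 ?inE // step_sign0 mulr1. Qed.

Lemma order_sign_anti c d : c != d -> order_sign d c = - order_sign c d.
Proof. by move=> cd; rewrite /order_sign lt_total //; case: lt;
  rewrite ?opprK. Qed.

Definition parallel c d := touch set0 c == touch set0 d.

Lemma circ1_off c A : ~~ meets c A -> (A \in circ [set c]) = (A \in circ set0).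
Proof. by move=> cA; rewrite -[[set c]]setU0 circ_off ?inE. Qed.

Lemma touch1_merge c : exists2 W, touch [set c] c = [set W] &
    forall f, meets f W = [exists A in touch set0 c, meets f A].
Proof. by have := @touch_merge set0 c; rewrite setU0 inE; apply. Qed.

Lemma card_circ1 c : #|circ set0| = #|circ [set c]|.+1.
Proof. by rewrite -[[set c]]setU0 -card_circ_merge ?inE. Qed.

(** Flipping [c] contracts the edge [c], after which [d] is a loop exactly when it was parallel to
    [c]. Otherwise an end [A] of [d] avoids [c] and survives, and the other end survives or is
    absorbed in [W], which differs from [A]. *)
Lemma card_touch1 c d : c != d ->
  #|touch [set c] d| = if parallel c d then 1%N else 2%N.
Proof.
move=> cd; have [W TW tchW] := touch1_merge c.
have WT : W \in touch [set c] c by rewrite TW set11.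
have [WF cW] : W \in circ [set c] /\ meets c W by move: WT;
  rewrite inE => /andP[].
have := card_touch12 [set c] d; have [/eqP cpd|ncpd] := boolP (parallel c d).
  suff /subset_leq_card : touch [set c] d \subset [set W] by rewrite cards1; lia.
  rewrite -TW; apply/subsetP=> A; rewrite !inE => /andP[AF dA]; rewrite AF /=.
  apply: contraTT dA => cA; rewrite circ1_off // in AF.
  by have /setP/(_ A) := cpd; rewrite !inE AF (negbTE cA) /= => <-.
have : ~~ (touch set0 d \subset touch set0 c).
  apply: contra ncpd => sub; rewrite /parallel eq_sym eqEcard sub.
  by rewrite !loopless0.
case/subsetPn=> A; rewrite !inE => /andP[A0 dA]; rewrite A0 /= => cA.
have AF : A \in circ [set c] by rewrite circ1_off.
suff [B [BF dB BA]] : exists B, [/\ B \in circ [set c], meets d B & B != A].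
  have : [set A; B] \subset touch [set c] d.
    by apply/subsetP=> X /set2P[]->; rewrite inE ?AF ?BF.
  by move/subset_leq_card; rewrite cards2 eq_sym BA => le2 [T1|//];
    rewrite T1 in le2.
have : #|touch set0 d :\ A| = 1%N.
  by have := cardsD1 A (touch set0 d); rewrite loopless0 !inE A0 dA /= => -[].
move/eqP/cards1P => [B /setP/(_ B)]; rewrite !inE eqxx => /and3P[BA B0 dB].
have [cB|cB] := boolP (meets c B); last by exists B; rewrite circ1_off.
exists W; split=> //; last by apply: contraNneq cA => <-.
by rewrite tchW; apply/exists_inP; exists B; rewrite // inE B0.
Qed.

Lemma card_circ2 c d : c != d -> ~~ parallel c d -> (#|circ [set c;
  d]| + 2 = #|circ set0|)%N.
Proof.
move=> cd /negbTE ncd; have dc : d \notin [set c] by rewrite inE eq_sym.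
have := card_circ_merge dc; rewrite setUC card_touch1 // ncd => /(_ erefl).
by rewrite (card_circ1 c); lia.
Qed.

(** * The edge set G of a cycle: no parallel edges, even degree at every circle *)

Section Cycle.
Variable G : {set I}.
Hypothesis nparallelG : {in G &, forall c d, c != d -> ~~ parallel c d}.
Hypothesis evenG : forall A, A \in circ set0 ->
  ~~ odd #|[set c in G | meets c A]|.

Lemma forestG1 F c : F \subset G -> #|F| = 1%N -> c \in G :\: F ->
  #|touch F c| = 2%N.
Proof.
move=> FG /eqP/cards1P[e defF];
  rewrite {F}defF sub1set inE in FG * => /andP[ce cG].
rewrite inE in ce; rewrite card_touch1 1?eq_sym //.
by rewrite (negbTE (nparallelG _ _ _)) // eq_sym.
Qed.

(** Contracting [e] merges its ends [A] and [B]. Each of them has an odd number of edges of [G]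
    besides [e], and these are different edges because none is parallel to [e]. *)
Lemma evenG1 F w : F \subset G -> #|F| = 1%N -> w \in circ F ->
  ~~ odd #|[set c in G :\: F | meets c w]|.
Proof.
move=> FG /eqP/cards1P[e defF]; rewrite {F}defF sub1set in FG * => wF.
have card_off A : #|[set c in G | meets c A]| =
  (meets e A + #|[set c in G :\ e | meets c A]|)%N.
  rewrite (cardsD1 e) !inE FG; congr (_ + _)%N; apply: eq_card => c.
  by rewrite !inE andbA.
have [ew|ew] := boolP (meets e w); last first.
  by have := evenG; move=> /(_ w); rewrite -(circ1_off ew) card_off (negbTE ew);
    apply.
have [W TW tchW] := touch1_merge e.
have {wF} -> : w = W by apply/set1P; rewrite -TW inE wF.
have /eqP/cards2P[A [B [AB TAB]]] := loopless0 e.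
have [A0 eA] : A \in circ set0 /\ meets e A.
  by apply/andP; have := set21 A B; rewrite -TAB inE.
have [B0 eB] : B \in circ set0 /\ meets e B.
  by apply/andP; have := set22 A B; rewrite -TAB inE.
have := evenG A0; have := evenG B0;
  rewrite !card_off eA eB !oddD /= !negbK => oB oA.
rewrite (_ : [set c in G :\ e | meets c W] =
  [set c in G :\ e | meets c A] :|: [set c in G :\ e | meets c B]); last first.
  apply/setP=> c; rewrite !inE tchW -andb_orr; congr (_ && _).
  apply/exists_inP/orP => [[X]|[cX|cX]]; first by rewrite TAB => /set2P[]->; auto.
    by exists A; rewrite // TAB !inE eqxx.
  by exists B; rewrite // TAB !inE eqxx orbT.
rewrite cardsU (_ : _ :&: _ = set0) ?cards0 ?subn0 ?oddD ?oA ?oB //.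
apply/setP=> c; rewrite !inE; apply/negbTE/negP.
case/andP=> /andP[/andP[ce cG] cA] /andP[_ cB].
case/negP: (nparallelG cG FG ce);
  rewrite /parallel eq_sym eqEcard !loopless0 TAB andbT.
by apply/subsetP=> X /set2P[]->; rewrite inE ?A0 ?B0.
Qed.

(** Number of two-step paths from [U] over the empty set to [set0] over [[set c; d]] that flip [c]
    first, when [d] still joins two circles after that flip. *)
Definition pairlifts c d U :=
  #|[set w in circ [set c] | step c set0 U [set w] && meets d w]|.

(** If [c] joins the two special circles, their union stays special; if [c] meets just one of them,
    the other stays special; if it meets neither, no step is possible. That [d] meets the remaining
    special circle then becomes a condition symmetric in [c] and [d]. *)
Lemma pairlifts2 c d u v : u != v -> u \in circ set0 -> v \in circ set0 ->
  pairlifts c d [set u; v] = (meets c u && meets d v) || (meets c v && meets d u).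
Proof.
move=> uv u0 v0; have [W TW tchW] := touch1_merge c.
have stepE w : step c set0 [set u; v] [set w] =
  [forall A in circ set0, meets c A || ((A \in [set u; v]) == (A \in [set w]))].
  rewrite /step setU0 cards1 cards2 uv (_ : (_ == _)%N) //.
  by rewrite (card_circ1 c); apply/eqP; lia.
have offP w : meets c u = false -> step c set0 [set u; v] [set w] -> w = u.
  move=> cu; rewrite stepE => /forall_inP/(_ u u0).
  by rewrite cu !inE eqxx /= => /eqP/esym/eqP.
have offP' w : meets c v = false -> step c set0 [set u; v] [set w] -> w = v.
  move=> cv; rewrite stepE => /forall_inP/(_ v v0).
  by rewrite cv !inE eqxx orbT /= => /eqP/esym/eqP.
rewrite /pairlifts.
case cu: (meets c u); case cv: (meets c v) => /=.
- have defT : touch set0 c = [set u; v].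
    apply/esym/eqP; rewrite eqEcard loopless0 cards2 uv andbT.
    by apply/subsetP=> X /set2P[]->; rewrite inE ?u0 ?v0 ?cu ?cv.
  have tdW : meets d W = meets d u || meets d v.
    rewrite tchW; apply/exists_inP/orP => [[X]|[cX|cX]].
    + by rewrite defT => /set2P[]->; auto.
    + by exists u; rewrite // defT !inE eqxx.
    + by exists v; rewrite // defT !inE eqxx orbT.
  have WT : W \in touch [set c] c by rewrite TW set11.
  have [WF cW] : W \in circ [set c] /\ meets c W by move: WT;
    rewrite inE => /andP[].
  rewrite orbC -tdW; rewrite (_ : [set w in _ | _] =
    if meets d W then [set W] else set0).
    by case: meets; rewrite ?cards1 ?cards0.
  apply/setP=> w; rewrite (fun_if (fun S : {set V} => w \in S)) !inE.
  apply/and3P/idP => [[wF sw dw]|]; last first.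
    case: ifP => // dW /eqP->; split=> //; rewrite stepE; apply/forall_inP=> A A0.
    case cA: (meets c A) => //=; rewrite !inE.
    have -> : (A == W) = false by apply: contraFF cA => /eqP->.
    have -> : (A == u) = false by apply: contraFF cA => /eqP->.
    by have -> : (A == v) = false by apply: contraFF cA => /eqP->.
  have cw : meets c w.
    apply: contraTT sw => cw; rewrite stepE negb_forall; apply/existsP; exists w.
    rewrite negb_imply -(circ1_off cw) wF /= (negbTE cw) /= !inE eqxx.
    have -> : (w == u) = false by apply: contraNF cw => /eqP->.
    by have -> : (w == v) = false by apply: contraNF cw => /eqP->.
  have wW : w = W by apply/set1P; rewrite -TW inE wF.
  by rewrite -wW dw eqxx.
- rewrite orbF (_ : [set w in _ | _] = if meets d v then [set v] else set0).
    by case: meets; rewrite ?cards1 ?cards0.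
  apply/setP=> w; rewrite (fun_if (fun S : {set V} => w \in S)) !inE.
  apply/and3P/idP => [[wF /(offP' _ cv) -> ->] //|]; case: ifP => // dv /eqP->.
  split=> //; first by rewrite circ1_off ?cv.
  rewrite stepE; apply/forall_inP=> A A0; case cA: (meets c A) => //=;
    rewrite !inE.
  by have -> : (A == u) = false by apply: contraFF cA => /eqP->.
- rewrite (_ : [set w in _ | _] = if meets d u then [set u] else set0).
    by case: meets; rewrite ?cards1 ?cards0.
  apply/setP=> w; rewrite (fun_if (fun S : {set V} => w \in S)) !inE.
  apply/and3P/idP => [[wF /(offP _ cu) -> ->] //|]; case: ifP => // du /eqP->.
  split=> //; first by rewrite circ1_off ?cu.
  rewrite stepE; apply/forall_inP=> A A0; case cA: (meets c A) => //=;
    rewrite !inE.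
  have -> : (A == v) = false by apply: contraFF cA => /eqP->.
  by rewrite orbF.
- apply/eqP; rewrite cards_eq0; apply/eqP/setP=> w; rewrite !inE;
    apply/negbTE/negP.
  case/and3P=> _ sw _; move: (offP w cu sw) uv; rewrite (offP' w cv sw) => ->.
  by rewrite eqxx.
Qed.

Lemma pairlifts_sym c d U : U \subset circ set0 ->
  pairlifts c d U = pairlifts d c U.
Proof.
move=> U0; have [/cards2P[u [v [uv defU]]]|Un2] := boolP (#|U| == 2%N).
  move: U0; rewrite defU subUset !sub1set => /andP[u0 v0].
  by rewrite !pairlifts2 // orbC ![meets d _ && _]andbC.
have pl0 e f : pairlifts e f U = 0%N.
  apply/eqP; rewrite cards_eq0; apply/eqP/setP=> w;
    rewrite !inE /step setU0 cards1.
  by apply/negbTE; rewrite !negb_and (card_circ1 e) -orbA; apply/or4P;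
    apply: Or42; lia.
by rewrite !pl0.
Qed.

Lemma step_pullback_double (z y : {set I} -> {set V} -> int) F U :
  (forall F U, U \subset circ F -> z F U = 2 * y F U) ->
  step_pullback z F U = 2 * step_pullback y F U.
Proof.
move=> zy; rewrite /step_pullback mulr_sumr; apply: eq_bigr => c _;
  rewrite mulrCA; congr (_ * _).
by rewrite mulr_sumr; apply: eq_bigr => U' /andP[U's _]; apply: zy.
Qed.

Lemma antisym_sum0 (h : I -> I -> int) : (forall c d, h d c = - h c d) ->
  \sum_c \sum_d h c d = 0.
Proof.
move=> anti; suff : \sum_c \sum_d h c d = - \sum_c \sum_d h c d by lia.
rewrite [LHS]exchange_big -sumrN; apply: eq_bigr => c _; rewrite -sumrN.
by apply: eq_bigr => d _; apply: anti.
Qed.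

(* The two orders of flipping c and d have the same number of intermediate
   states, and opposite signs. *)
Lemma step_pullback_pullback F U : U \subset circ F ->
  step_pullback (step_pullback (subset_cochain 1 G)) F U = 0.
Proof.
move=> Us; have [F0|Fn0] := eqVneq F set0; last first.
  rewrite /step_pullback big1 // => c; rewrite inE => cF;
    rewrite big1 ?mulr0 // => U' _.
  by rewrite -/(step_pullback _ _ _) step_pullback_subset cardsU1 cF eqSS
    cards_eq0 (negbTE Fn0).
rewrite {F}F0 in Us *; rewrite {1}/step_pullback setC0.
(* [h c d] is the part of the composite that flips first [c] and then [d]. *)
pose h c d : int := if [&& c \in G, d \in G & c != d] then order_sign d c *
  (pairlifts c d U)%:R else 0.
rewrite -[RHS](@antisym_sum0 h); last first.
  move=> c d; rewrite /h pairlifts_sym // andbCA [d == c]eq_sym.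
  case: ifP => [/and3P[_ _ cd]|]; last by rewrite oppr0.
  by rewrite (order_sign_anti cd) mulNr opprK.
apply: eq_big => [c|c _]; first by rewrite inE.
rewrite step_sign0 mul1r setU0 (eq_bigr (fun U' => \sum_(d in ~: [set c])
    step_sign d [set c] * ((step d [set c] U' set0)%:R *
      (d |: [set c] \subset G)%:R))).
  rewrite exchange_big /= big_mkcond /=; apply: eq_bigr => d _.
  rewrite !inE /h; have [->|dc] := eqVneq d c; first by rewrite !andbF.
  rewrite andbT subUset !sub1set andbC; case: ifP => [/andP[cG dG]|]; last first.
    by move=> _; rewrite big1 // => U' _; rewrite !mulr0.
  rewrite -mulr_sumr step_sign1; congr (_ * _).
  rewrite (eq_bigr (fun U' =>
    if (#|U'| == 1%N) && (U' \subset [set A | meets d A]) then 1 else 0));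
      last first.
    move=> U' /andP[U's _]; rewrite mulr1 step_set0 ?inE //;
      first by case: (_ && _).
    by rewrite forestG1 ?cards1 ?sub1set // !inE dc.
  rewrite -big_mkcondr /= (eq_bigl (fun U' : {set V} =>
    ((U' \subset circ [set c]) && step c set0 U U' &&
     (U' \subset [set A | meets d A])) && (#|U'| == 1%N))); last first.
    by move=> U'; rewrite -!andbA [in RHS](andbC (_ \subset [set _ | _])).
  rewrite (sum_set1 (fun U' => (U' \subset circ [set c]) && step c set0 U U' &&
     (U' \subset [set A | meets d A]))).
  rewrite sumr_const; congr (_ *+ _); apply: eq_card => w.
  by rewrite -topredE /= !inE !sub1set inE andbA.
by move=> U' _; rewrite step_pullback_subset cards1.
Qed.

(** For s_+ the cycle is [y], tested against [ph]; for s_- it is [ps], tested against [z]. The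
    numbers [k] and [t] confine the support of [ph] to one bidegree. *)
Definition torsion_data :=
  exists k t, exists z y ph ps : {set I} -> {set V} -> int,
  [/\ forall F U, U \subset circ F -> step_image z F U = 2 * y F U,
      forall F U, U \subset circ F -> step_image y F U = 0,
      forall F U, U \subset circ F -> step_pullback ph F U = 2 * ps F U,
      forall F U, U \subset circ F -> step_pullback ps F U = 0 &
      (forall F U, ph F U != 0 -> #|F| = k /\ #|circ F| = t + #|U|.*2)%N /\
      exists x, \sum_F \sum_(U : {set V} | U \subset circ F) y F U * ph F U =
        2 * x + 1].

Lemma odd_parity x : parity x = 1 -> exists q, x = 2 * q + 1.
Proof.
move=> px; have : parity (x - 1) == 0 by rewrite /parity rmorphB /= -/(parity x)
  px subrr.
rewrite parity_eq0 => /dvdzP[q xq]; exists q; lia.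
Qed.

Lemma set1_setD1 (e : I) : [set e] :\ e = set0.
Proof. by apply/setP=> d; rewrite !inE andNb. Qed.

Lemma torsion_data_odd : odd #|G| -> torsion_data.
Proof.
move=> oddG; pose a := fun _ : {set I} => 1 : int.
have forest0 F c : F \subset G -> #|F| = 0%N -> c \in G :\: F ->
  #|touch F c| = 2%N.
  by move=> _ /eqP; rewrite cards_eq0 => /eqP->.
have even0 F w : F \subset G -> #|F| = 0%N -> w \in circ F ->
    ~~ odd #|[set c in G :\: F | meets c w]|.
  by move=> _ /eqP; rewrite cards_eq0 => /eqP->; rewrite setD0; apply: evenG.
have half_image1 e : half_image a [set e] = 1.
  rewrite /half_image (big_pred1 e) ?set1_setD1 ?step_sign0 // => c; rewrite !inE.
  by case: eqP => // ->; rewrite set1_setD1 loopless0.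
(* One merge lowers the number of circles by one, which gives [t]. *)
exists 1%N, #|circ set0|.-1, (one_special 0 a), (no_special 1 (half_image a)),
  (subset_cochain 0 G).
(* The division is exact by [step_pullback_subset_even]. *)
exists (fun F U => (step_pullback (subset_cochain 0 G) F U %/ 2)%Z).
have pullback_half F U : U \subset circ F ->
  step_pullback (subset_cochain 0 G) F U =
    2 * (step_pullback (subset_cochain 0 G) F U %/ 2)%Z.
  by move=> Us; have /divzK := step_pullback_subset_even forest0 even0 Us; lia.
split=> //.
- move=> F U Us; apply: step_image_one_special => // /eqP/cards1P[e ->].
  rewrite big_pred0 // => c; rewrite !inE; case: eqP => // ->.
  by rewrite set1_setD1 loopless0.
(* Two flips [e] and [f] can be made in two orders, with opposite signs and both coefficients 1. *)
- move=> F U Us; apply: (@step_image_no_special _ _ F) =>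
    // [F' /eqP/cards1P[e ->] _|/eqP/cards2P[e [f [ef ->]]]].
    by rewrite addn1 -card_circ1.
  rewrite sum_set2 // set2D1l // set2D1r // !half_image1 !step_sign1
    (order_sign_anti ef).
  by rewrite !mulr1 subrr.
(* The halved pullback lives over the empty set, which is not of the form [c |: F]. *)
- move=> F U Us; rewrite {1}/step_pullback big1 // => c; rewrite inE => cF;
    rewrite big1 ?mulr0 // => U' _.
  by rewrite /= step_pullback_subset cardsU1 cF div0z.
split=> [F U|].
  rewrite /subset_cochain /no_special;
    case: ifP => // /andP[/cards1P[e ->] /eqP->] _.
  by rewrite !cards1 cards0 addn0 (card_circ1 e).
apply: odd_parity; rewrite subset_cochain_pairing (eq_bigl (fun F =>
  (F \subset G) && (#|F| == 1%N))).
  rewrite (sum_set1 (fun F => F \subset G)) (eq_bigr (fun=> 1)) ?sumr_const =>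
    [|e _ //].
  rewrite (_ : #|_| = #|G|) ?parity_nat ?oddG //.
  by apply: eq_card => c; rewrite -topredE /= sub1set.
by move=> F; rewrite andbC.
Qed.

Lemma torsion_data_even : ~~ odd #|G| -> G != set0 -> torsion_data.
Proof.
move=> evG /set0Pn[e0 e0G].
pose weight e : int := (parallel e e0)%:R.
pose a F : int := [forall e in F, parallel e e0]%:R.
have a1 e : a [set e] = weight e.
  congr (_%:R); congr nat_of_bool; apply/forall_inP/idP => [|pe f /set1P -> //].
  by apply; rewrite set11.
have weight_parallel c d : parallel c d ->
  weight c = weight d by rewrite /weight /parallel => /eqP->.
(* If [e] and [f] are parallel, flipping one after the other is not a merge, in agreement with the
   equality of their weights. *)
have half_image2 e f : e != f -> half_image a [set e;
  f] = order_sign e f * (weight f - weight e).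
  move=> ef; rewrite /half_image big_mkcondr sum_set2 // set2D1l // set2D1r //
    !a1.
  rewrite !card_touch1 // 1?eq_sym // !step_sign1 (order_sign_anti ef) /parallel
    [touch _ f == _]eq_sym -/(parallel e f).
  case pef: (parallel e f) => /=; last by ring.
  by rewrite (weight_parallel _ _ pef) [weight f - _]subrr mulr0 addr0.
exists 2%N, #|circ set0|.-2, (one_special 1 a), (no_special 2 (half_image a)),
  (subset_cochain 1 G).
exists (fun F U => (step_pullback (subset_cochain 1 G) F U %/ 2)%Z).
have pullback_half F U : U \subset circ F ->
  step_pullback (subset_cochain 1 G) F U =
    2 * (step_pullback (subset_cochain 1 G) F U %/ 2)%Z.
  by move=> Us; have /divzK := step_pullback_subset_even forestG1 evenG1 Us; lia.
split=> //.
- move=> F U Us; apply: step_image_one_special => // /eqP/cards2P[e [f [ef ->]]].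
  rewrite big_mkcondr sum_set2 // set2D1l // set2D1r // !a1 !step_sign1.
  rewrite !card_touch1 // 1?eq_sym // /parallel [touch _ f == _]eq_sym
    -/(parallel e f).
  have [pef|] := boolP (parallel e f); last by rewrite /= addr0.
  have fe : f \notin [set e] by rewrite inE eq_sym.
  have fe' : e \notin [set f] by rewrite inE.
  (* For parallel [e] and [f] the second flip splits in both orders or in neither; the two
     contributions then have equal weights and opposite signs. *)
  have -> : #|touch [set e; f] e| = #|touch [set e; f] f|.
    have := card_circ_step fe; have := card_circ_step fe'.
    rewrite [f |: _]setUC (card_touch1 ef) (card_touch1 (_ : f != e)) 1?eq_sym //
      pef.
    rewrite /parallel eq_sym -/(parallel e f) pef.
    by have := card_circ1 e; have := card_circ1 f; lia.
  rewrite (weight_parallel _ _ pef) (order_sign_anti ef); case: ifP => _;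
    rewrite ?addr0 //.
  by rewrite mulNr subrr.
- move=> F U Us; apply: (@step_image_no_special _ _ F) =>
    // [F' /eqP/cards2P[e [f [ef ->]]]|].
    rewrite half_image2 // => H; apply: card_circ2 => //;
      apply: contraNN H => pef.
    by rewrite (weight_parallel _ _ pef) subrr mulr0.
  move=> F3; have /card_gt0P[e eF] : (0 < #|F|)%N by rewrite F3.
  have := card_setD1 eF; rewrite F3 => -[/esym/eqP/cards2P[f [g [fg FeE]]]].
  have [ef eg] : e != f /\ e != g.
    have := setD1_notin e F; rewrite FeE !inE negb_or => /andP[]; by split.
  have fe : f != e by rewrite eq_sym.
  have defF : F = e |: [set f; g] by rewrite -FeE setD1K.
  rewrite (big_setD1 e eF) FeE sum_set2 // defF.
  have -> : (e |: [set f; g]) :\ f = [set e; g].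
    by rewrite setUCA setU1K // !inE negb_or fe fg.
  have -> : (e |: [set f; g]) :\ g = [set e; f].
    by rewrite setUA setUC setU1K // !inE negb_or eq_sym eg eq_sym fg.
  (* Differences of weights form a signed coboundary: over the three terms every weight occurs
     twice, with opposite signs. *)
  rewrite !half_image2 // !step_signU1 ?inE // -!/(order_sign _ _) !step_sign1
    (order_sign_anti ef) (order_sign_anti eg) (order_sign_anti fg).
  by rewrite /=; ring.
(* Twice this pullback is the composite of two pullbacks of the cochain, which vanishes. *)
- move=> F U Us; suff : 2 * step_pullback (fun F U =>
    (step_pullback (subset_cochain 1 G) F U %/ 2)%Z) F U = 0 by lia.
  by rewrite -(step_pullback_double _ _ pullback_half) step_pullback_pullback.
split=> [F U|].
  rewrite /subset_cochain /no_special;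
    case: ifP => // /andP[/cards2P[e [f [ef ->]]] /eqP->].
  rewrite pnatr_eq0 eqb0 negbK subUset !sub1set => /andP[eG fG].
  by rewrite cards2 ef cards0 addn0 -(card_circ2 ef) ?nparallelG // addn2.
have weightG e : e \in G -> weight e = (e == e0)%:R.
  move=> eG; rewrite /weight; have [->|ne] := eqVneq e e0;
    first by rewrite /parallel eqxx.
  by rewrite (negbTE (nparallelG eG e0G ne)).
apply: odd_parity; rewrite subset_cochain_pairing parity_sum.
(* Modulo 2 the coefficient at a pair in [G] tells whether it contains [e0], the only edge of [G]
   with nonzero weight; so [#|G| - 1] pairs count. *)
rewrite (eq_bigr (fun F : {set I} => parity (e0 \in F)%:R)); last first.
  move=> F /andP[/cards2P[e [f [ef ->]]]];
    rewrite subUset !sub1set => /andP[eG fG].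
  rewrite half_image2 // parity_sign !weightG // !inE ![e0 == _]eq_sym.
  have [ee|ene] := eqVneq e e0; last by rewrite subr0.
  have -> : (f == e0) = false by apply/negbTE; rewrite -ee eq_sym.
  exact: val_inj.
rewrite -parity_sum -natr_sum parity_nat.
rewrite (_ : (\sum_(F | _) _)%N = #|[set [set e0; f] | f in G :\ e0]|).
  rewrite card_in_imset => [|f g].
    by have := cardsD1 e0 G; rewrite e0G => cG; move: evG;
      rewrite cG /= negbK => ->.
  rewrite !inE => /andP[fe _] /andP[ge _] /setP/(_ f).
  by rewrite !inE eqxx orbT (negbTE fe) => /esym/eqP.
rewrite -sum1_card big_mkcond [RHS]big_mkcond; apply: eq_bigr => F _.
rewrite (_ : (F \in _) = (#|F| == 2%N) && (F \subset G) && (e0 \in F)).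
  by case: (#|F| == 2%N); case: (F \subset G); case: (e0 \in F).
apply/imsetP/andP => [[f /setD1P[fe fG] ->]|[/andP[F2 FG] e0F]].
  by rewrite cards2 [e0 == f]eq_sym fe subUset !sub1set e0G fG set21.
have := card_setD1 e0F; rewrite (eqP F2) => -[/esym/eqP/cards1P[f Ff]].
have fF : f \in F :\ e0 by rewrite Ff set11.
exists f; last by rewrite -Ff setD1K.
by move: fF; rewrite !inE => /andP[-> /(subsetP FG)].
Qed.
End Cycle.
End Core.

(** * Elements of order 2 in Khovanov homology *)

Lemma homology_order2 (U V W : zmodType) (f : {additive U -> V})
    (g : {additive V -> W}) (y : V) (z : U) :
  g y = 0 -> f z = y *+ 2 -> (forall u, y <> f u) ->
  has_element_of_order_2 (homology f g).
Proof.
move=> gy0 fz y_bd.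
have yc : y \in is_cycle g by rewrite unfold_in gy0 eqxx.
pose c : cycles g := Cycle yc.
pose Q := @Quotient.quot (cycles g) (@is_boundary _ _ _ f g).
have pi0 (u : cycles g) : (\pi_Q u == 0) = (u \in @is_boundary _ _ _ f g).
  by rewrite -(raddf0 (\pi_Q)) -Quotient.idealrBE subr0.
exists (\pi_Q c); split.
  by rewrite pi0 unfold_in; apply/asboolP => -[u /y_bd].
apply/eqP; rewrite -raddfMn pi0 unfold_in; apply/asboolP.
by exists z; rewrite raddfMn fz.
Qed.

Lemma direct_sum_order2 (I : eqType) (V : I -> zmodType) (i : I) :
  has_element_of_order_2 (V i) -> has_element_of_order_2 (direct_sum V).
Proof.
case=> x [x0 x2]; pose v : Defs.family V := dfwith (fun j => 0 : V j) x.
have vs : v \in @finite_support _ V.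
  rewrite unfold_in; apply/asboolP; exists [:: i] => j; rewrite inE eq_sym => ij.
  by rewrite /v dfwith_out.
exists (DirectSum vs); split.
  apply: contraNneq x0 => /(congr1 (fun u : direct_sum V => dsum_val u i)) /=.
  by rewrite /v dfwith_in => ->.
apply: val_inj; rewrite raddfMn /=; apply: functional_extensionality_dep => j.
rewrite -[LHS]/(v j + v j) -[RHS]/(0 : V j) /v.
by case: dfwithP => [|k _]; rewrite ?addr0 // -mulr2n.
Qed.

Section Criterion.
Variable D : link_diagram.
Implicit Types (S : enhanced D) (ij : int * int).

Lemma incidence_bidegree S S' : incidence S S' != 0 ->
  bidegree S' = ((bidegree S).1 - 2, (bidegree S).2).
Proof.
apply: contraNeq => ne; rewrite /incidence big_pred0 // => c.
by rewrite /incident_at (negbTE ne).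
Qed.

Lemma sum_basis ij (g : enhanced D -> int) :
  \sum_(S : basis D ij) g (val S) = \sum_(S | bidegree S == ij) g S.
Proof. by rewrite [RHS](big_sub [pred S | bidegree S == ij]). Qed.

Lemma basis_bidegree ij (S : basis D ij) : bidegree (val S) = ij.
Proof. exact/eqP/(valP S). Qed.

(** Incidence numbers vanish unless the bidegrees match, so the sum over one basis extends to all
    enhanced states. *)
Lemma diffE ij kl (z : enhanced D -> int) (S' : basis D kl) :
  kl = (ij.1 - 2, ij.2) ->
  @diff D ij kl [ffun S => z (val S)] S' = \sum_S z S * incidence S (val S').
Proof.
move=> klE; rewrite ffunE (eq_bigr (fun S : basis D ij =>
  z (val S) * incidence (val S) (val S'))).
  rewrite (sum_basis _ (fun S => z S * incidence S (val S'))) big_mkcond.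
  apply: eq_bigr => S _; case: ifP => // /eqP neS.
  have [->|/incidence_bidegree] := eqVneq (incidence S (val S')) 0;
    first by rewrite mulr0.
  rewrite basis_bidegree => E; have := etrans (esym klE) E; case=> E1 E2;
    case: neS.
  by rewrite [LHS]surjective_pairing [RHS]surjective_pairing E2 /=; congr pair;
    apply: (addIr (-2)); rewrite E1.
by move=> S _; rewrite ffunE.
Qed.

(** If [y] were the boundary of [u], its pairing with [phi] would be that of [u] with the coboundary
    of [phi], which is even. *)
Lemma khovanov_order2 ij (z y phi : enhanced D -> int) :
  (forall S', bidegree S' = ij -> \sum_S z S * incidence S S' = 2 * y S') ->
  (forall S', \sum_S y S * incidence S S' = 0) ->
  (forall S, (2 %| \sum_S' incidence S S' * phi S')%Z) ->
  ~~ (2 %| \sum_(S | bidegree S == ij) phi S * y S)%Z ->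
  has_element_of_order_2 (khovanov D).
Proof.
case: ij => i j zy yd dphi oddy; apply: (@direct_sum_order2 _ _ (i, j)).
apply: (@homology_order2 _ _ _ _ _ [ffun S => y (val S)] [ffun S => z (val S)]).
- by apply/ffunP=> S'; rewrite diffE // yd ffunE.
- apply/ffunP=> S'; rewrite diffE /=; last by congr pair; lia.
  by rewrite zy ?basis_bidegree // !mulr2n !ffunE mulrDl mul1r.
move=> u yu; case/negP: oddy.
rewrite -(sum_basis _ (fun S => phi S * y S)).
have -> : \sum_(S : basis D (i, j)) phi (val S) * y (val S) =
   \sum_(S : basis D (i + 2, j)) u S * \sum_S' incidence (val S) S' * phi S'.
  rewrite (eq_bigr (fun S' : basis D (i, j) =>
    \sum_(S : basis D (i + 2, j)) u S * (incidence (val S) (val S') *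
      phi (val S')))).
    rewrite exchange_big; apply: eq_bigr => S _; rewrite -mulr_sumr;
      congr (_ * _).
    rewrite (sum_basis _ (fun S' => incidence (val S) S' * phi S')) big_mkcond.
    apply: eq_bigr => S' _; case: ifP => // /eqP neS'.
    have [->|/incidence_bidegree] := eqVneq (incidence (val S) S') 0;
      first by rewrite mul0r.
    by rewrite basis_bidegree /= => E; case: neS'; rewrite E; congr pair; lia.
  move=> S' _; have /ffunP/(_ S') := yu; rewrite !ffunE => ->.
  by rewrite mulr_sumr; apply: eq_bigr => S _; rewrite mulrC mulrA.
rewrite -parity_eq0 parity_sum big1 // => S _; rewrite parityM.
by have := dphi (val S); rewrite -parity_eq0 => /eqP->; rewrite mulr0.
Qed.
End Criterion.

(** * Enhanced states relative to a constant state *)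

Section Flips.
Variables (D : link_diagram) (b : bool).
Implicit Types (X Y : enhanced D) (F : {set crossing D}) (U : {set {set point
  D}}) (c : crossing D).

Definition flipped_state F : state D := [ffun c => (c \in F) (+) b].
Definition flipped X := [set c | tag X c != b].
Definition special X : {set {set point D}} :=
  [set val A | A in [set A | tagged X A != b]].

Definition enhanced_of (s : state D) U : enhanced D :=
  Tagged (fun s => {ffun circle s -> bool}) [ffun A : circle s =>
    (val A \in U) (+) b].
Definition lt_cross : rel (crossing D) := fun c c' => (c < c')%N.
Definition circ F := circles (flipped_state F).

Lemma flipped_stateK F X : tag X = flipped_state F -> flipped X = F.
Proof.
by move=> XF; apply/setP=> c; rewrite inE XF ffunE; case: (c \in F); case: (b).
Qed.

Lemma tagE X : tag X = flipped_state (flipped X).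
Proof. by apply/ffunP=> c; rewrite ffunE inE; case: (tag X c); case: b. Qed.

Lemma special_val X (A : circle (tag X)) : (val A \in special X) =
  (tagged X A != b).
Proof. by rewrite mem_imset ?inE //; apply: val_inj. Qed.

Lemma tagged_special X (A : circle (tag X)) : tagged X A =
  (val A \in special X) (+) b.
Proof. by rewrite special_val; case: (tagged X A); case: b. Qed.

Lemma special_sub X : special X \subset circ (flipped X).
Proof.
rewrite /circ -tagE; apply/subsetP=> A /imsetP[B _ ->]; exact: (valP B).
Qed.

Lemma enhanced_ofK X : enhanced_of (flipped_state (flipped X)) (special X) = X.
Proof.
rewrite -tagE; case: X => s t; congr existT; apply/ffunP=> A.
by rewrite ffunE -(@tagged_special (existT _ s t)).
Qed.

Lemma special_enhanced_of s U : U \subset circles s ->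
  special (enhanced_of s U) = U.
Proof.
move=> Us; apply/setP=> A; apply/imsetP/idP => [[B]|AU].
  by rewrite inE ffunE => + ->; case: (_ \in U); case: b.
exists (Sub A (subsetP Us A AU)); rewrite ?inE ?ffunE ?SubK ?AU //.
by case: (b).
Qed.

Lemma sum_enhanced (G : enhanced D -> int) :
  \sum_X G X = \sum_F \sum_(U : {set {set point D}} | U \subset circ F) G
    (enhanced_of (flipped_state F) U).
Proof.
rewrite pair_big_dep /=.
rewrite (reindex_onto (fun p => enhanced_of (flipped_state p.1) p.2)
  (fun X => (flipped X, special X))) /=; last by move=> X _; apply: enhanced_ofK.
apply: eq_bigl => -[F U] /=;
  rewrite xpair_eqE (flipped_stateK (F := F)) // eqxx /=.
apply/eqP/idP => [<-|]; last exact: special_enhanced_of.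
by have := special_sub (enhanced_of (flipped_state F) U);
  rewrite (flipped_stateK (F := F)).
Qed.

Lemma tauE X : tau X = marker b * (#|circ (flipped X)|%:R - (#|special X|.*2)%:R).
Proof.
have cardU : #|special X| = (\sum_(A : circle (tag X)) (tagged X A != b))%N.
  rewrite card_imset; last exact: val_inj.
  by rewrite -sum1_card big_mkcond /=; apply: eq_bigr => A _; rewrite inE;
    case: ifP.
have cardC : #|circ (flipped X)| = (\sum_(A : circle (tag X)) 1)%N.
  by rewrite sum1_card /circ -tagE card_sig; apply: eq_card => A.
rewrite cardU cardC -mul2n natrM !natr_sum mulr_sumr -sumrB mulr_sumr.
by apply: eq_bigr => A _; case: (tagged X A); case: b.
Qed.

Lemma sigmaE X : sigma X = marker b * ((ncross D)%:R - (#|flipped X|.*2)%:R).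
Proof.
have cardF : #|flipped X| = (\sum_(c : crossing D) (tag X c != b))%N.
  by rewrite -sum1_card big_mkcond /=; apply: eq_bigr => A _; rewrite inE;
    case: ifP.
have cardC : ncross D = (\sum_(c : crossing D) 1)%N by rewrite sum1_card card_ord.
rewrite cardF [X in X%:R - _]cardC -mul2n natrM !natr_sum mulr_sumr -sumrB
  mulr_sumr.
by apply: eq_bigr => A _; case: (tag X A); case: b.
Qed.

Lemma same_signs_offC c X Y : same_signs_off c X Y = same_signs_off c Y X.
Proof.
suff sub X' Y' : same_signs_off c X' Y' ->
  same_signs_off c Y' X' by apply/idP/idP; apply: sub.
move/forallP=> H; apply/forallP=> A; apply/forallP=> A';
  have /forallP/(_ A)/implyP HA := H A'.
by apply/implyP=> /andP[/eqP e nt]; rewrite eq_sym HA // -e eqxx.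
Qed.

Lemma differ_only_atC c X Y : differ_only_at c X Y = differ_only_at c Y X.
Proof. by apply/forallP/forallP => H c'; have := H c';
  rewrite [tag X c' == _]eq_sym. Qed.

Lemma differ_only_atE c X Y : differ_only_at c X Y ->
  c \notin flipped X -> flipped Y = c |: flipped X.
Proof.
move=> /forallP dXY; rewrite inE negbK => /eqP Xc; apply/setP=> c'; rewrite !inE.
have /eqP := dXY c'; have [->|_] := eqVneq c' c.
  by rewrite Xc /= eq_sym.
by move/negbFE/eqP->.
Qed.

Lemma flipped_state_flip c F : c \notin F ->
  flip c (flipped_state F) = flipped_state (c |: F).
Proof.
move=> cF; apply/ffunP=> c'; rewrite !ffunE !inE; case: eqP => [->|_].
  by rewrite (negbTE cF); case: b.
by rewrite addbF.
Qed.

Lemma same_signs_step c X Y : c \notin flipped X -> flipped Y = c |: flipped X ->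
  same_signs_off c X Y =
  [forall A in circ (flipped X), touches c A || ((A \in special X) == (A \in
    special Y))].
Proof.
move=> cX FY; apply/forallP/forall_inP => [H A AX|H A].
  have [//|ntA] := boolP (touches c A); rewrite /=.
  have AsX : A \in circles (tag X) by rewrite tagE.
  have AsY : A \in circles (tag Y) by rewrite tagE FY -flipped_state_flip //
    circles_flip.
  have /forallP/(_ (Sub A AsY)) := H (Sub A AsX).
  rewrite !tagged_special !SubK eqxx ntA /=.
  by case: (A \in special X); case: (A \in special Y); case: b.
apply/forallP=> A'; apply/implyP=> /andP[/eqP AA' ntA].
have AX : val A \in circ (flipped X) by rewrite /circ -tagE; apply: valP.
have := H _ AX; rewrite (negbTE ntA) /= !tagged_special -AA' => /eqP->.
by [].
Qed.

(** The transpose for [b = false] makes every step add a crossing to the flipped set, whichever the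
    adequate state. *)
Definition outward_incidence X Y := if b then incidence X Y else incidence Y X.
Definition outward_incident_at c X Y :=
  if b then incident_at c X Y else incident_at c Y X.

(** The condition on [sigma] fixes the direction of the flip; given that, the condition on the
    second degree amounts to the count of circles in [step]. *)
Lemma outward_incident_atE c X Y : outward_incident_at c X Y =
  [&& c \notin flipped X, flipped Y == c |: flipped X &
      step circ (@touches D) c (flipped X) (special X) (special Y)].
Proof.
have -> : outward_incident_at c X Y =
  [&& (if b then bidegree Y == ((bidegree X).1 - 2, (bidegree X).2)
       else bidegree X == ((bidegree Y).1 - 2, (bidegree Y).2)),
      differ_only_at c X Y & same_signs_off c X Y].
  by rewrite /outward_incident_at /incident_at; case: b;
    rewrite // differ_only_atC same_signs_offC.
have bideg : c \notin flipped X -> flipped Y = c |: flipped X ->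
  (if b then bidegree Y == ((bidegree X).1 - 2, (bidegree X).2)
       else bidegree X == ((bidegree Y).1 - 2, (bidegree Y).2)) =
  (#|circ (flipped Y)| + #|special X|.*2 == (#|circ (flipped X)| + #|special
    Y|.*2).+1)%N.
  move=> cX FY; rewrite /bidegree /= !xpair_eqE !sigmaE !tauE.
  have -> : #|flipped Y| = #|flipped X|.+1 by rewrite FY cardsU1 cX.
  rewrite -!/(circ _) !natz;
    move: #|circ _| #|special _| #|circ _| #|special _| #|flipped X| =>
      c1 s1 c2 s2 f.
  rewrite /marker; case: b; apply/idP/idP; lia.
apply/and3P/and3P => [[deg dXY off]|[cX /eqP FY /andP[deg off]]].
  (* If [c] were flipped in [X], then [Y] would have one flip fewer and [sigma] would change by 2 in
     the wrong direction. *)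
  have cX : c \notin flipped X.
    apply/negP=> cX; have cY : c \notin flipped Y.
      move: cX (forallP dXY c); rewrite !inE eqxx => + /eqP.
      by case: (tag X c); case: (tag Y c); case: b.
    have FX : flipped X = c |: flipped Y by apply: differ_only_atE;
      rewrite // differ_only_atC.
    move: deg; rewrite /bidegree /= !sigmaE.
    have -> : #|flipped X| = #|flipped Y|.+1 by rewrite FX cardsU1 cY.
    by rewrite /marker; case: b; rewrite xpair_eqE => /andP[/eqP + _]; lia.
  have FY := differ_only_atE dXY cX; split=> //; first by rewrite FY.
  by rewrite /step -FY -bideg // deg -same_signs_step.
split; first by rewrite bideg // FY.
  apply/forallP=> c'; rewrite 2!tagE FY !ffunE !inE; have [->|_] := eqVneq c' c.
    by rewrite inE in cX; move: cX; case: (tag X c); case: b.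
  by rewrite eqxx.
by rewrite same_signs_step.
Qed.

(* When [b = false], the negative markers are the unflipped ones: replacing them
   by the flipped ones in the sign of the differential costs a factor depending
   only on [c], which a change of signs of the basis removes. *)
Definition crossing_sign c : int :=
  if b then 1 else (-1) ^+ #|[set c' | lt_cross c c']|.
Definition state_sign F : int := \prod_(c in F) crossing_sign c.

Lemma crossing_sign_sq c : crossing_sign c * crossing_sign c = 1.
Proof. by rewrite /crossing_sign; case: b;
  rewrite ?mulr1 // -expr2 sqrr_sign. Qed.

Lemma state_sign_sq F : state_sign F * state_sign F = 1.
Proof. by rewrite /state_sign -big_split big1 //= => c _;
  apply: crossing_sign_sq. Qed.

Lemma state_signU1 c F : c \notin F ->
  state_sign (c |: F) = crossing_sign c * state_sign F.
Proof. by move=> cF; rewrite /state_sign big_setU1. Qed.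

(** For [s = false] the negative markers after [c] are the unflipped crossings there, so their
    number and that of the flipped ones add up to the number of all crossings after [c]. The source
    state then has [c] flipped as well, but [c] is not after itself. *)
Lemma sign_after (s : bool) F c : c \notin F ->
  (-1) ^+ #|[set c' | lt_cross c c' &&
    ~~ ((c' \in if s then F else c |: F) (+) s)]| =
  (if s then 1 else (-1) ^+ #|[set c' | lt_cross c c']|) * step_sign lt_cross c F.
Proof.
move=> cF; rewrite /step_sign; case: s.
  rewrite mul1r; congr (_ ^+ _); apply: eq_card => c'.
  by rewrite !inE addbT negbK andbC.
rewrite -(cardsID F [set c' | lt_cross c c']) exprD mulrAC.
rewrite (_ : [set c' | lt_cross c c'] :&: F = [set c' in F | lt_cross c c']).
  rewrite -expr2 sqrr_sign mul1r; congr (_ ^+ _); apply: eq_card => c'.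
  rewrite !inE addbF negb_or andbC; case cc': (lt_cross c c');
    rewrite ?andbF //= !andbT.
  by case: eqP cc' => //= ->; rewrite /lt_cross ltnn.
by apply/setP=> c'; rewrite !inE andbC.
Qed.

Lemma neg_afterE c X Y : c \notin flipped X -> flipped Y = c |: flipped X ->
  (-1) ^+ neg_after c (if b then X else Y) =
    crossing_sign c * step_sign lt_cross c (flipped X).
Proof.
move=> cX FY; rewrite /crossing_sign -sign_after //; congr (_ ^+ _);
  apply: eq_card => c'.
rewrite !inE tagE ffunE -/(lt_cross c c').
by rewrite (fun_if flipped) FY.
Qed.

Lemma outward_incidenceE X Y : outward_incidence X Y =
  state_sign (flipped X) * state_sign (flipped Y) *
  \sum_(c | [&& c \notin flipped X, flipped Y == c |: flipped X &
      step circ (@touches D) c (flipped X) (special X) (special Y)]) step_sign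
        lt_cross c (flipped X).
Proof.
have -> : outward_incidence X Y =
  \sum_(c | outward_incident_at c X Y) (-1) ^+ neg_after c (if b then X else Y).
  by rewrite /outward_incidence /incidence /outward_incident_at; case: b.
rewrite mulr_sumr; apply: eq_big => [c|c]; rewrite outward_incident_atE //.
case/and3P=> cX /eqP FY _; rewrite FY state_signU1 // neg_afterE //.
by rewrite [state_sign _ * (_ * _)]mulrCA state_sign_sq mulr1.
Qed.

Lemma flipped_enhanced_of F U : flipped (enhanced_of (flipped_state F) U) = F.
Proof. exact: flipped_stateK. Qed.

Definition signed (z : {set crossing D} -> {set {set point D}} -> int) X : int :=
  state_sign (flipped X) * z (flipped X) (special X).

(** The sign of the source state cancels against the one in [signed], and that of the target comes
    out as a factor; a step through [c] into [Y] starts at the flipped set [FY :\ c]. *)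
Lemma signed_step_image z Y : \sum_X signed z X * outward_incidence X Y =
  signed (step_image lt_cross circ (@touches D) z) Y.
Proof.
rewrite sum_enhanced /signed /step_image mulr_sumr.
set FY := flipped Y; set UY := special Y.
rewrite (eq_bigr (fun F => \sum_(c | (c \notin F) && (FY == c |: F))
   \sum_(U : {set {set point D}} | U \subset circ F)
     state_sign FY * (step_sign lt_cross c F *
       if step circ (@touches D) c F U UY then z F U else 0))); last first.
  move=> F _; rewrite exchange_big /=; apply: eq_bigr => U Us.
  rewrite outward_incidenceE flipped_enhanced_of special_enhanced_of // -/FY -/UY.
  under [X in _ * (_ * X)]eq_bigl => c do rewrite andbA.
  have reorder (p q r s : int) : p * q * (p * r * s) =
    (p * p) * (r * (q * s)) by ring.
  rewrite big_mkcondr /= -mulr_sumr reorder state_sign_sq mul1r; congr (_ * _).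
  rewrite mulr_sumr; apply: eq_bigr => c _; case: ifP => _; rewrite ?mulr0 //.
  by rewrite mulrC.
rewrite (exchange_big_dep (mem FY)) /=; last first.
  by move=> F c _ /andP[_ /eqP->]; rewrite !inE eqxx.
apply: eq_bigr => c cFY; rewrite (big_pred1 (FY :\ c)).
  by rewrite -!mulr_sumr -big_mkcondr.
move=> F /=; apply/andP/eqP => [[cF /eqP ->]|->]; first by rewrite setU1K.
by rewrite !inE eqxx setD1K.
Qed.

Lemma signed_step_pullback z X : \sum_Y outward_incidence X Y * signed z Y =
  signed (step_pullback lt_cross circ (@touches D) z) X.
Proof.
rewrite sum_enhanced /signed /step_pullback mulr_sumr.
set FX := flipped X; set UX := special X.
rewrite (eq_bigr (fun F => \sum_(c | (c \notin FX) && (F == c |: FX))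
   \sum_(U : {set {set point D}} | U \subset circ F)
     state_sign FX * (step_sign lt_cross c FX *
       if step circ (@touches D) c FX UX U then z F U else 0))); last first.
  move=> F _; rewrite exchange_big /=; apply: eq_bigr => U Us.
  rewrite outward_incidenceE flipped_enhanced_of special_enhanced_of // -/FX -/UX.
  under [X in (_ * X) * _]eq_bigl => c do rewrite andbA.
  have reorder (p q r s : int) : p * r * s * (r * q) =
    (r * r) * (p * (q * s)) by ring.
  rewrite big_mkcondr /= -mulr_sumr reorder state_sign_sq mul1r; congr (_ * _).
  rewrite mulr_sumr; apply: eq_bigr => c _; case: ifP => _; rewrite ?mulr0 //.
  by rewrite mulrC.
rewrite (exchange_big_dep (mem (~: FX))) /=; last by move=> F c _ /andP[cF _];
  rewrite in_setC.
apply: eq_bigr => c; rewrite inE => cFX; rewrite (big_pred1 (c |: FX)).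
  by rewrite -!mulr_sumr -big_mkcondr.
by move=> F /=; rewrite cFX.
Qed.

Lemma circ_flip_off c F A : c \notin F -> ~~ touches c A ->
  (A \in circ (c |: F)) = (A \in circ F).
Proof. by move=> cF cA; rewrite /circ -flipped_state_flip // circles_flip. Qed.

Lemma card_touch_circ F c : (0 < #|touch circ (@touches D) F c| <= 2)%N.
Proof. by have := card_touching (flipped_state F) c;
  rewrite /touching /touch => ->; case: connect. Qed.

Lemma touch_circ_merge F c : c \notin F -> #|touch circ (@touches D) F c| = 2%N ->
  exists2 W, touch circ (@touches D) (c |: F) c = [set W] &
    forall f, touches f W = [exists A in touch circ (@touches D) F c, touches f
      A].
Proof.
move=> cF T2; exists (cover (touching (flipped_state F) c)).
  by rewrite -(touching_flip_merge T2) flipped_state_flip.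
by move=> f; apply: touches_bigcup.
Qed.

Lemma lt_cross_total c d : c != d -> lt_cross d c = ~~ lt_cross c d.
Proof. by rewrite /lt_cross -val_eqE /=; lia. Qed.

Lemma outward_incidence_bidegree X Y : outward_incidence X Y != 0 ->
  if b then bidegree Y = ((bidegree X).1 - 2, (bidegree X).2)
  else bidegree X = ((bidegree Y).1 - 2, (bidegree Y).2).
Proof. by rewrite /outward_incidence; case: b => /incidence_bidegree. Qed.

Lemma bidegree_level X k t : #|flipped X| = k ->
  #|circ (flipped X)| = (t + #|special X|.*2)%N ->
  bidegree X = (marker b * ((ncross D)%:R - k.*2%:R),
                marker b * ((ncross D)%:R - k.*2%:R) + 2 * (marker b * t%:R)).
Proof.
move=> Xk Xt; rewrite /bidegree sigmaE tauE Xk Xt.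
by congr (_, _ + _ * (_ * _)); rewrite natrD addrK.
Qed.

Lemma torsion_data_khovanov : torsion_data lt_cross circ (@touches D) ->
  has_element_of_order_2 (khovanov D).
Proof.
move=> [k [t [z [y [ph [ps [zy yd phs psd [supp [x xE]]]]]]]]].
have {xE} pairing : \sum_X signed ph X * signed y X = 2 * x + 1.
  rewrite -xE sum_enhanced; apply: eq_bigr => F _; apply: eq_bigr => U Us.
  rewrite /signed flipped_enhanced_of special_enhanced_of //.
  by rewrite mulrACA state_sign_sq mul1r mulrC.
(* The bidegree shared by all states in the support of [ph]. *)
pose q := (marker b * ((ncross D)%:R - k.*2%:R),
           marker b * ((ncross D)%:R - k.*2%:R) + 2 * (marker b * t%:R)) : int *
             int.
have {supp} phq X : signed ph X != 0 -> bidegree X = q.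
  rewrite mulf_eq0 negb_or => /andP[_ /supp[Xk Xt]].
  exact: bidegree_level.
have zy' Y : \sum_X signed z X * outward_incidence X Y = 2 * signed y Y.
  by rewrite signed_step_image /signed zy ?special_sub // mulrCA.
have yd' Y : \sum_X signed y X * outward_incidence X Y = 0.
  by rewrite signed_step_image /signed yd ?special_sub // mulr0.
have phs' X : \sum_Y outward_incidence X Y * signed ph Y = 2 * signed ps X.
  by rewrite signed_step_pullback /signed phs ?special_sub // mulrCA.
have psd' X : \sum_Y outward_incidence X Y * signed ps Y = 0.
  by rewrite signed_step_pullback /signed psd ?special_sub // mulr0.
have odd_pairing : ~~ (2 %| \sum_X signed ph X * signed y X)%Z.
  by rewrite pairing; apply/negP=> /dvdzP[r]; lia.
have pair_q (f : enhanced D -> int) :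
    \sum_(X | bidegree X == q) signed ph X * f X = \sum_X signed ph X * f X.
  rewrite big_mkcond; apply: eq_bigr => X _; case: eqP => // Xq.
  by have [->|/phq] := eqVneq (signed ph X) 0; first by rewrite mul0r.
have := @outward_incidence_bidegree; move: zy' yd' phs' psd';
  rewrite /outward_incidence; case: b => zy' yd' phs' psd' bideg.
  apply: (@khovanov_order2 D q (signed z) (signed y) (signed ph)) => //.
    by move=> X; rewrite phs' dvdz_mulr.
  by rewrite pair_q.
(* For [b = false] the differential is the transpose: it sends [ph] to twice [ps], one degree lower,
   and [z] is the cocycle modulo 2. *)
apply: (@khovanov_order2 D (q.1 - 2, q.2) (signed ph) (signed ps) (signed z)).
- by move=> X _; rewrite -phs'; apply: eq_bigr => Y _; rewrite mulrC.
- by move=> X; rewrite -[RHS](psd' X); apply: eq_bigr => Y _; rewrite mulrC.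
- move=> Y; rewrite (eq_bigr (fun X => signed z X * incidence Y X)).
    by rewrite zy' dvdz_mulr.
  by move=> X _; rewrite mulrC.
(* Both sides pair [z] with [ph] through the matrix, evaluated in the two orders; hence
   [z . ps = y . ph]. *)
have E : 2 * \sum_(X | bidegree X == (q.1 - 2, q.2)) signed z X * signed ps X =
    2 * \sum_X signed ph X * signed y X.
  rewrite !mulr_sumr.
  rewrite (eq_bigr (fun X => \sum_Y signed ph Y * (signed z X * incidence Y X)));
    last first.
    move=> X _; rewrite mulrCA -phs' mulr_sumr; apply: eq_bigr => Y _.
    by ring.
  rewrite exchange_big; apply: eq_bigr => Y _; rewrite -mulr_sumr mulrCA -zy'.
  have [->|/phq Yq] := eqVneq (signed ph Y) 0; first by rewrite !mul0r.
  congr (_ * _); rewrite big_mkcond; apply: eq_bigr => X _; case: eqP => // Xq.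
  have [->|/bideg] := eqVneq (incidence Y X) 0; first by rewrite mulr0.
  by rewrite Yq.
by rewrite (mulfI (isT : (2 : int) != 0) E).
Qed.
End Flips.

(** * From a cycle of the state graph to its set of edges *)

Lemma next_next_neq (T : eqType) (p : seq T) x :
  uniq p -> (3 <= size p)%N -> x \in p -> next p (next p x) != x.
Proof.
move=> Up p3 xp; have [i q defq] := rot_to xp.
rewrite -!(next_rot i Up) defq.
have := p3; rewrite -(size_rot i) defq; have := Up; rewrite -(rot_uniq i) defq.
case: q {defq} => [|y [|z q]] //= /and3P[].
rewrite !inE !negb_or => /and3P[xy xz _] /andP[yz _] _ _.
by rewrite eqxx [y == x]eq_sym (negbTE xy) eqxx eq_sym.
Qed.

(** One edge from each vertex to its successor makes up [G]. A circle on the cycle meets exactly the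
    edges to its successor and from its predecessor; a circle off the cycle meets none. *)
Lemma cycle_edges (D : link_diagram) (s : state D) : loopless s ->
  has_cycle_ge3 s ->
  exists G : {set crossing D}, [/\ G != set0,
    {in G &, forall c d, c != d -> touching s c != touching s d} &
    forall A, A \in circles s -> ~~ odd #|[set c in G | touches c A]|].
Proof.
move=> noloop [p [p3 /andP[cyc_p uniq_p]]].
have [x0 x0p] : exists x, x \in p.
  by case: (p) p3 => // x q _; exists x; rewrite mem_head.
have touching_edge c : touching s c = [set val (edge_ends s c).1;
  val (edge_ends s c).2].
  by rewrite touchingE.
have [f fP] : exists f : circle s -> crossing D, forall x, x \in p ->
    touching s (f x) = [set val x; val (next p x)].
  have edge x : exists c, x \in p -> touching s c = [set val x; val (next p x)].
    have [xp|_] := boolP (x \in p).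
      have /existsP[c /orP[] /eqP Ec] := next_cycle cyc_p xp.
        by exists c; rewrite touching_edge Ec.
      by exists c; rewrite touching_edge Ec setUC.
    (* For [x] off the cycle any crossing will do as a default value; one exists because the cycle
       is nonempty. *)
    by have /existsP[c _] := next_cycle cyc_p x0p; exists c.
  by have [f fP] := fin_all_exists edge; exists f.
have next_neq x : x \in p -> next p x != x.
  move=> xp; apply/eqP=> nx; have := next_cycle cyc_p xp; rewrite nx.
  case/existsP=> c; rewrite orbb => /eqP Ec; have := noloop c.
  by rewrite Ec eqxx.
(* If [x] and [y] were distinct with the same pair of ends, each would be the successor of the
   other, which a cycle of length at least 3 excludes. *)
have f_inj : {in p &, forall x y, touching s (f x) = touching s (f y) -> x = y}.
  move=> x y xp yp; rewrite !fP // => /setP E.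
  have := E (val x); rewrite set21 => /esym/set2P[/val_inj //|/val_inj xy].
  have := E (val (next p x));
    rewrite set22 => /esym/set2P[/val_inj yx|/val_inj nn].
    by have := next_next_neq uniq_p p3 yp; rewrite -xy yx eqxx.
  by have := prev_next uniq_p x; rewrite nn prev_next.
exists [set f x | x in p]; split.
- by apply/set0Pn; exists (f x0); apply/imsetP; exists x0.
- move=> c d /imsetP[x xp ->] /imsetP[y yp ->]; apply: contraNneq => E.
  by rewrite (f_inj x y).
move=> A sA; pose a : circle s := Sub A sA.
have -> : [set c in [set f x | x in p] | touches c A] =
    [set f x | x in [set x in p | (x == a) || (next p x == a)]].
  apply/setP=> c; rewrite inE; apply/andP/imsetP => [[/imsetP[x xp ->]]|[x]].
    move=> tA; exists x => //; rewrite inE xp /=.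
    have : A \in touching s (f x) by rewrite inE sA.
    by rewrite fP // => /set2P[] E; apply/orP; [left|right];
      rewrite -val_eqE /= E.
  rewrite inE => /andP[xp xa] ->; split; first exact: imset_f.
  suff : A \in touching s (f x) by rewrite inE => /andP[].
  by rewrite fP //; case/orP: xa => /eqP xa; rewrite !inE xa eqxx ?orbT.
rewrite card_in_imset; last first.
  move=> x y; rewrite !inE => /andP[xp _] /andP[yp _] E.
  by apply: f_inj; rewrite ?E.
have [ap|ap] := boolP (a \in p); last first.
  rewrite (_ : [set x in p | _] = set0) ?cards0 //; apply/setP=> x; rewrite !inE.
  apply/negbTE/negP=> /andP[xp /orP[] /eqP xa]; first by rewrite -xa xp in ap.
  by rewrite -xa mem_next xp in ap.
rewrite (_ : [set x in p | _] = [set a; prev p a]).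
  rewrite cards2; have := next_neq (prev p a);
    rewrite mem_prev next_prev // => /(_ ap).
  by move=> ->.
apply/setP=> x; rewrite !inE;
  apply/andP/orP => [[xp /orP[]/eqP xa]|[/eqP->|/eqP->]].
- by left; rewrite xa.
- by right; rewrite -xa prev_next.
- by rewrite ap eqxx.
by rewrite mem_prev ap next_prev // eqxx orbT.
Qed.

Lemma khovanov_torsion (D : link_diagram) b :
  loopless (flipped_state b (set0 : {set crossing D})) ->
  has_cycle_ge3 (flipped_state b (set0 : {set crossing D})) ->
  has_element_of_order_2 (khovanov D).
Proof.
move=> noloop cyc; have [G [G0 nparallel evenG]] := cycle_edges noloop cyc.
have loop0 c : #|touch (circ b) (@touches D) set0 c| = 2%N.
  rewrite -[touch _ _ _ _]/(touching (flipped_state b set0) c) card_touching.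
  by have := noloop c; rewrite -val_eqE /= eq_circle_through => ->.
apply: (@torsion_data_khovanov D b).
have [oddG|noddG] := boolP (odd #|G|).
  exact: (torsion_data_odd (@lt_cross_total D) (@circ_flip_off D b)
    (@card_touch_circ D b) (@touch_circ_merge D b) loop0 evenG oddG).
exact: (torsion_data_even (@lt_cross_total D) (@circ_flip_off D b)
    (@card_touch_circ D b) (@touch_circ_merge D b) loop0 nparallel evenG noddG
      G0).
Qed.

Theorem mainTheorem3 (D : link_diagram) :
  (plus_adequate D /\ has_cycle_ge3 (state_plus D)) \/
  (minus_adequate D /\ has_cycle_ge3 (state_minus D)) ->
  has_element_of_order_2 (khovanov D).
Proof.
have plusE : state_plus D = flipped_state true set0.
  by apply/ffunP=> c; rewrite !ffunE inE.
have minusE : state_minus D = flipped_state false set0.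
  by apply/ffunP=> c; rewrite !ffunE inE.
rewrite /plus_adequate /minus_adequate plusE minusE.
by case=> -[]; apply: khovanov_torsion.
Qed.
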